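(* Let $\Delta$ be the clique complex of a chordal graph with at least two maximal cliques, with facets $S_1,\ldots,S_e$ in a fixed leaf order, facet cardinalities $n_m=|S_m|$, separator cardinalities $r_1,\ldots,r_{e-1}$, number of vertices $N$, and $d=\dim\Delta$. Then the graded Betti numbers of the skeletons of $\Delta$ are as follows. (a) For the $(-1)$-skeleton, $\beta_{i,i}(\mathbb K[\Delta_{(-1)}])=\binom{N}{i}$ for $0\le i\le N$, and all other graded Betti numbers vanish. (b) For the $0$-skeleton, $\beta_{i,i+1}(\mathbb K[\Delta_{(0)}])=i\binom{N}{i+1}$ for $1\le i\le N-1$, and all other Betti numbers in positive homological degrees vanish. (c) Let $1\le k<d$. For every $i\ge1$, the only possible nonzero Betti numbers of $\mathbb K[\Delta_{(k)}]$ in positive homological degrees are $$\beta_{i,i+1}(\mathbb K[\Delta_{(k)}])=-\sum_{m=1}^e\binom{N-n_m}{i+1}+\sum_{m=1}^{e-1}\binom{N-r_m}{i+1}$$ and $$\beta_{i,i+k+1}(\mathbb K[\Delta_{(k)}])=\sum_{t=k+2}^{i+k+1}(-1)^{k-t}\binom{N-t}{i+k+1-t}\left(\sum_{m=1}^e\binom{n_m}{t}-\sum_{m=1}^{e-1}\binom{r_m}{t}\right).$$ (d) For $k=d$, the skeleton is the full complex $\Delta$. Its Betti numbers in positive homological degrees are given by $$\beta_{i,i+1}(\mathbb K[\Delta])=-\sum_{m=1}^e\binom{N-n_m}{i+1}+\sum_{m=1}^{e-1}\binom{N-r_m}{i+1}\qquad(i\ge1),$$ and all other Betti numbers in positive homological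 degrees vanish.
   Context: $\mathbb K$ is a field. For a finite set $X$ with $|X|=N$, put $R=\mathbb K[x:x\in X]$ with the standard grading. A simplicial complex $\Sigma$ on $X$ is a collection of subsets (faces) of $X$ closed under inclusion; elements of $X$ not lying in any face (ghost vertices) are allowed. Facets are the maximal faces, a face $F$ has dimension $|F|-1$, and $\dim\Sigma$ is the largest dimension of a face. The $k$-skeleton $\Sigma_{(k)}$ consists of all faces of dimension at most $k$, viewed as a complex on the same set $X$; $\Sigma_{(-1)}=\{\varnothing\}$. $I_\Sigma\subseteq R$ is generated by the monomials $\prod_{x\in A}x$ with $A\subseteq X$, $A\notin\Sigma$; $\mathbb K[\Sigma]=R/I_\Sigma$; and $\beta_{i,j}$ denotes graded Betti numbers over $R$. Chordal clique complexes: let $\Delta$ be the complex of cliques of a finite chordal graph with vertex set $X$, $|X|=N$, having $e\ge2$ maximal cliques. A leaf order of its facets (maximal cliques) is an ordering $S_1,\ldots,S_e$ such that for each $m\ge2$ there is $p(m)<m$ (with $S_{p(m)}$ called a branch of $S_m$) satisfying $S_m\cap S_i\subseteq S_m\cap S_{p(m)}$ for all $i<m$; such an order exists. For $1\le m\le e-1$ the separators are $Q_m=(S_1\cup\cdots\cup S_m)\cap S_{m+1}=S_{p(m+1)}\cap S_{m+1}$ (possibly empty), and $r_m=|Q_m|$. One has $N=\sum_{m=1}^e n_m-\sum_{m=1}^{e-1}r_m$ and $d=\dim\Delta=\max_m n_m-1$. Binomial convention: $\binom ab=0$ if $a<0$, $b<0$ or $b>a$; otherwise it is the usual binomial coefficient.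 *)

(* Defs.v *)
From HB Require Import structures.
From mathcomp Require Import all_boot all_order all_algebra.
From mathcomp Require Export mpoly.

Set Implicit Arguments.
Unset Strict Implicit.
Unset Printing Implicit Defensive.

Import Order.TTheory GRing.Theory Num.Theory.
Local Open Scope ring_scope.

(* 'C(a, b) extended by zero: 'C(m, p) = 0 already when p > m. *)
Definition zbin (a b : int) : int :=
  match a, b with
  | Posz m, Posz p => ('C(m, p))%:Z
  | _, _ => 0
  end.

(* A complex on T is given by its set of faces. Not every x : T need be a
   vertex of a face (ghost vertices). *)
Section Complexes.
Variable T : finType.
Implicit Types (Sigma : {set {set T}}) (F : {set T}).

Definition facets Sigma : {set {set T}} :=
  [set F | maxset (fun A => A \in Sigma) F].

Definition face_dim F : int := #|F|%:Z - 1.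

(* Intended for complexes containing set0, so that the values are >= -1. *)
Definition cdim Sigma : int := (\max_(F in Sigma) #|F|)%:Z - 1.

Definition skeleton (k : int) Sigma : {set {set T}} :=
  [set F in Sigma | face_dim F <= k].

End Complexes.

Section Graphs.
Variables (T : finType) (adj : rel T).

Definition chordal : Prop :=
  forall c : seq T, ucycle adj c -> (3 < size c)%N ->
    exists x y : T,
      [&& x \in c, y \in c, adj x y, y != next c x & x != next c y].

Definition clique_complex : {set {set T}} :=
  [set A : {set T} | [forall x in A, forall y in A, (x != y) ==> adj x y]].

End Graphs.

(* Lists of facets are indexed from 0: S_(m+1) is nth set0 S m. *)
Section LeafOrders.
Variable T : finType.
Implicit Types (Sigma : {set {set T}}) (S : seq {set T}).

Definition leaf_order Sigma S : Prop :=
  [/\ uniq S, S =i facets Sigma &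
      forall m : nat, (0 < m < size S)%N ->
        exists2 p : nat, (p < m)%N &
          forall i : nat, (i < m)%N ->
            nth set0 S m :&: nth set0 S i
              \subset nth set0 S m :&: nth set0 S p].

Definition facet_card S (m : nat) : nat := #|nth set0 S m|.

(* separator S m is Q_(m+1), for m + 1 < size S. *)
Definition separator S (m : nat) : {set T} :=
  (\bigcup_(i < m.+1) nth set0 S i) :&: nth set0 S m.+1.

Definition sep_card S (m : nat) : nat := #|separator S m|.

End LeafOrders.

Section StanleyReisner.
Variables (K : fieldType) (T : finType).

(* K[x : x in T]; the variable of x : T is 'X_(enum_rank x). *)
Definition sring := {mpoly K[#|T|]}.

Definition set_mono (A : {set T}) : sring := \prod_(x in A) 'X_(enum_rank x).

Definition sr_ideal (Sigma : {set {set T}}) (p : sring) : Prop :=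
  exists c : {set T} -> sring,
    p = \sum_(A : {set T} | A \notin Sigma) c A * set_mono A.

End StanleyReisner.

Section GradedBetti.
Variables (K : fieldType) (n : nat).
Local Notation R := {mpoly K[n]}.

(* Data of a sequence ... -> F_2 -> F_1 -> F_0 -> R/I of finite graded free
   R-modules F_i = \bigoplus_a R(- gdeg i a), where a < grank i. Elements of
   F_i are row vectors and maps act on them by right multiplication. The
   augmentation F_0 -> R/I is given by representatives in R of the images of
   the basis elements. *)
Record free_seq := FreeSeq {
  grank : nat -> nat;
  gdeg : forall i : nat, 'I_(grank i) -> nat;
  gaug : 'cV[R]_(grank 0);
  gdiff : forall i : nat, 'M[R]_(grank i.+1, grank i)
}.

(* The matrices of degree-preserving maps
   \bigoplus_a R(- s a) -> \bigoplus_b R(- t b). The bound t b <= s a is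
   needed because of truncated subtraction. *)
Definition graded_mx (p q : nat) (s : 'I_p -> nat) (t : 'I_q -> nat)
    (M : 'M[R]_(p, q)) : Prop :=
  forall a b, M a b != 0 ->
    (t b <= s a)%N /\ M a b \is (s a - t b)%N.-homog.

(* F is a minimal graded free resolution of R/I. The last clause is
   d(F_(i+1)) \subset (x_0, ..., x_(n-1)) F_i: a polynomial lies in the
   irrelevant ideal iff its constant coefficient is zero. *)
Record min_free_resolution (I : R -> Prop) (F : free_seq) : Prop := {
  mfr_aug_graded : graded_mx (@gdeg F 0) (fun _ : 'I_1 => 0%N) (gaug F);
  mfr_diff_graded :
    forall i, graded_mx (@gdeg F i.+1) (@gdeg F i) (gdiff F i);
  mfr_aug_surj :
    forall p : R, exists v : 'rV_(grank F 0), I (p - (v *m gaug F) 0 0);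
  mfr_exact0 :
    forall v : 'rV_(grank F 0),
      I ((v *m gaug F) 0 0) <-> exists w, v = w *m gdiff F 0;
  mfr_exactS :
    forall i (v : 'rV_(grank F i.+1)),
      v *m gdiff F i = 0 <-> exists w, v = w *m gdiff F i.+1;
  mfr_minimal : forall i a b, (gdiff F i a b)@_(0%MM) = 0
}.

(* beta is the table of graded Betti numbers of R/I over R: beta i j is the
   number of copies of R(-j) in the i-th module of a minimal graded free
   resolution of R/I. *)
Definition graded_betti (I : R -> Prop) (beta : nat -> nat -> nat) : Prop :=
  exists2 F : free_seq, min_free_resolution I F &
    forall i j, beta i j = #|[set a : 'I_(grank F i) | gdeg a == j]|.

End GradedBetti.

(* beta is the table of graded Betti numbers of K[Sigma]. *)
Definition sr_betti (K : fieldType) (T : finType) (Sigma : {set {set T}})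
    (beta : nat -> nat -> nat) : Prop :=
  graded_betti (@sr_ideal K T Sigma) beta.

(* Main.v *)
Require Import Defs.
From HB Require Import structures.
From mathcomp Require Import all_boot all_order all_algebra.
From mathcomp Require Import zify.
From Stdlib Require Import ClassicalEpsilon.

(** The Betti numbers of K[Sigma] are read off an explicit free resolution. For a
    complex Sigma on T, consider the pairs (F, G) of disjoint subsets of T with F a
    face; the pair has homological degree #|G| and internal degree #|F| + #|G|.
    The differential moves an element g of G either into the coefficient, as a
    variable, or into F when this gives a face, with opposite signs. In each
    multidegree a matching argument (cell_acyclic) shows that the resulting graded
    complex of free modules resolves K[Sigma] (sr_resolution_free). It is not
    minimal. However, a minimal resolution is a homotopy retract of any other
    graded free resolution, so the Betti numbers are the dimensions of the homology
    of the complex with all variables put to zero (betti_rank). There only the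
    moves of g into F survive. In internal degree j this is a complex of
    vector spaces whose s-th term, spanned by the pairs with #|F| = s, contributes
    to the Betti number in position (j - s, j): this is Hochster's formula in the
    form sr_betti_slices.

    For a complex whose facets admit a leaf order, this complex is exact at every
    s >= 2 (forest_acyclic): facets are added one at a time, each along a single
    simplex. At s = 0 it is exact when j > 0, since all vertices are faces. Hence
    only s = 1, the linear strand, remains, and its dimension is an Euler
    characteristic, that is an alternating sum of the numbers of pairs. These are
    f_s * C(N - s, j - s), with f_s the number of faces of size s, and
    f_s = sum_m C(n_m, s) - sum_m C(r_m, s) by the leaf order
    (face_count_first_faces). The alternating sum collapses by inclusion-exclusion
    (alternating_binomial).

    Passing to the k-skeleton truncates the complex after s = k + 1. For k >= 1 the
    part around s = 1 is unchanged, hence so is the linear strand; exactness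
    persists for 2 <= s <= k; and at s = k + 1 the homology becomes the image of the
    removed map, whose rank is again given by the exactness above it
    (clique_rank, betti_top). For k = -1 and k = 0 one or two terms are left and the
    ranks are immediate. *)

Set Implicit Arguments.
Unset Strict Implicit.
Unset Printing Implicit Defensive.

Import Order.TTheory GRing.Theory Num.Theory.
Local Open Scope ring_scope.

(** * Matrices indexed by finite sets *)

Section SetMatrices.
Variables (R : nzRingType) (P : finType).
Implicit Types (A B C : {set P}) (c : P -> P -> R).

Definition smx A B c : 'M[R]_(#|A|, #|B|) :=
  \matrix_(a, b) c (enum_val a) (enum_val b).

Definition kdelta (p q : P) : R := (p == q)%:R.

(** A row vector indexed by A is handled as a function on the ambient type, zero
    off A: sums over A then need no membership conditions, and comparing rows
    indexed by different subsets costs nothing. *)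
Definition zext A (v : 'rV[R]_#|A|) (p : P) : R :=
  \sum_(a | enum_val a == p) v 0 a.

Definition restr A (f : P -> R) : 'rV[R]_#|A| := \row_a f (enum_val a).

Lemma big_enum_set A (f : P -> R) :
  \sum_(a < #|A|) f (enum_val a) = \sum_(p in A) f p.
Proof. by rewrite [RHS]big_enum_val. Qed.

Lemma zext_val A (v : 'rV[R]_#|A|) a : zext v (enum_val a) = v 0 a.
Proof.
by rewrite /zext (eq_bigl (pred1 a)) ?big_pred1_eq // => b; rewrite (inj_eq enum_val_inj).
Qed.

Lemma zext_out A (v : 'rV[R]_#|A|) p : p \notin A -> zext v p = 0.
Proof.
move=> pA; rewrite /zext big1 // => a /eqP ap.
by move: pA; rewrite -ap enum_valP.
Qed.

Lemma set_enum_val A p : p \in A -> exists a : 'I_#|A|, p = enum_val a.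
Proof. by move=> pA; exists (enum_rank_in pA p); rewrite enum_rankK_in. Qed.

Lemma zext_restr A f p : p \in A -> zext (restr A f) p = f p.
Proof. by case/set_enum_val=> a ->; rewrite zext_val mxE. Qed.

Lemma restr_zext A (v : 'rV[R]_#|A|) : restr A (zext v) = v.
Proof. by apply/rowP => a; rewrite mxE zext_val. Qed.

Lemma eq_restr A f h : {in A, f =1 h} -> restr A f = restr A h.
Proof. by move=> fh; apply/rowP => a; rewrite !mxE fh ?enum_valP. Qed.

Lemma eq_smx A B c c' :
  {in A & B, forall p q, c p q = c' p q} -> smx A B c = smx A B c'.
Proof. by move=> cc; apply/matrixP => a b; rewrite !mxE cc ?enum_valP. Qed.

Lemma mul_row_smx A B c (v : 'rV_#|A|) :
  v *m smx A B c = restr B (fun q => \sum_(p in A) zext v p * c p q).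
Proof.
apply/rowP => b; rewrite !mxE -big_enum_set.
by apply: eq_bigr => a _; rewrite mxE zext_val.
Qed.

Lemma mul_smx A B C c c' :
  smx A B c *m smx B C c' = smx A C (fun p r => \sum_(q in B) c p q * c' q r).
Proof.
by apply/matrixP => a b; rewrite !mxE -big_enum_set; apply: eq_bigr => q _; rewrite !mxE.
Qed.

Lemma sum_kdelta_l B p (f : P -> R) :
  \sum_(q in B) kdelta p q * f q = if p \in B then f p else 0.
Proof.
rewrite (eq_bigr (fun q => if q == p then f p else 0)) => [|q _]; last first.
  rewrite /kdelta eq_sym; case: eqP => [->|_]; by rewrite ?mul1r ?mul0r.
rewrite -big_mkcondr /=; case: ifP => pB.
  rewrite (big_pred1 p) // => q /=; case: eqP => [->|]; by rewrite ?pB ?andbF.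
by rewrite big1 // => q /andP[qB /eqP qp]; rewrite -qp qB in pB.
Qed.

Lemma sum_kdelta_r B p (f : P -> R) :
  \sum_(q in B) f q * kdelta q p = if p \in B then f p else 0.
Proof.
rewrite -(sum_kdelta_l B p f); apply: eq_bigr => q _; rewrite /kdelta eq_sym.
by case: eqP; rewrite ?mulr0 ?mul0r ?mulr1 ?mul1r.
Qed.

End SetMatrices.

Section SetMatrixRank.
Variables (K : fieldType) (P : finType).
Implicit Types (A B : {set P}) (c : P -> P -> K).

(** Zero rows and columns do not contribute to the rank: each of the two matrices
    is the other one multiplied on both sides by rectangular identity matrices. *)
Lemma rank_smx_supp A B A' B' c : A' \subset A -> B' \subset B ->
  {in A & B, forall p q, ~~ ((p \in A') && (q \in B')) -> c p q = 0} ->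
  \rank (smx A B c) = \rank (smx A' B' c).
Proof.
move=> sA sB c0; apply/eqP; rewrite eqn_leq; apply/andP; split.
  have -> : smx A B c =
      smx A A' (@kdelta K P) *m smx A' B' c *m smx B' B (@kdelta K P).
    rewrite mul_smx mul_smx; apply: eq_smx => p q pA qB.
    rewrite sum_kdelta_r sum_kdelta_l.
    case pA': (p \in A'); last by rewrite if_same c0 // pA'.
    by case qB': (q \in B') => //; rewrite c0 // qB' andbF.
  by apply: leq_trans (mxrankM_maxl _ _) _; apply: mxrankM_maxr.
have -> : smx A' B' c =
    smx A' A (@kdelta K P) *m smx A B c *m smx B B' (@kdelta K P).
  rewrite mul_smx mul_smx; apply: eq_smx => p q pA qB.
  by rewrite sum_kdelta_r sum_kdelta_l (subsetP sA) ?(subsetP sB).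
by apply: leq_trans (mxrankM_maxl _ _) _; apply: mxrankM_maxr.
Qed.

(** A 0/1 diagonal matrix D factors as X *m X^T, where X selects the coordinates
    with entry 1 and X^T *m X is an identity matrix. *)
Lemma rank_indicator n (Q : pred 'I_n) :
  \rank (\matrix_(a, b) ((a == b) && Q a)%:R : 'M[K]_n) = #|[set a | Q a]|.
Proof.
set D := \matrix_(a, b) _; set A := [set a | Q a].
pose X : 'M[K]_(n, #|A|) := \matrix_(a, b) (a == enum_val b)%:R.
have DE : D = X *m X^T.
  apply/matrixP => a b; rewrite !mxE.
  rewrite (eq_bigr (fun k => kdelta K a (enum_val k) * kdelta K (enum_val k) b)); last first.
    by move=> k _; rewrite !mxE /kdelta eq_sym [b == _]eq_sym.
  rewrite (big_enum_set A (fun p => kdelta K a p * kdelta K p b)) sum_kdelta_r inE.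
  by rewrite /kdelta; case: eqP => [->|_] /=; case: ifP.
have XX : X^T *m X = 1%:M.
  apply/matrixP => a b; rewrite !mxE (bigD1 (enum_val a)) //= big1 => [|k /negPf kb].
    by rewrite !mxE eqxx mul1r addr0 (inj_eq enum_val_inj).
  by rewrite !mxE kb mul0r.
apply/eqP; rewrite eqn_leq; apply/andP; split.
  by rewrite DE (leq_trans (mxrankM_maxl _ _)) ?rank_leq_col.
have E : X^T *m D *m X = 1%:M by rewrite DE -!mulmxA XX mulmx1 XX.
rewrite -[X in (X <= _)%N](mxrank1 K) -E.
exact: leq_trans (mxrankM_maxl _ _) (mxrankM_maxr _ _).
Qed.

Lemma card_enum_val A (Q : pred P) :
  #|[set a : 'I_#|A| | Q (enum_val a)]| = #|[set p in A | Q p]|.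
Proof.
rewrite -[RHS]sum1_card (eq_bigl (fun p => (p \in A) && Q p)) => [|p]; last by rewrite inE.
by rewrite big_enum_val_cond -sum1_card; apply: eq_bigl => a; rewrite inE.
Qed.

End SetMatrixRank.

(** * Koszul operators with weights *)

Section KoszulSums.
Variables (T : finType) (R : comNzRingType).
Implicit Types (F G A : {set T}) (g h x : T) (v w : {set T} -> {set T} -> R).

Definition inv_sign g h : R := if (enum_rank h < enum_rank g)%N then -1 else 1.

Definition ksgn g G : R := \prod_(h in G) inv_sign g h.

Lemma inv_signC g h : g != h -> inv_sign g h = - inv_sign h g.
Proof.
move=> gh; rewrite /inv_sign; case: ltngtP => [||E] //; first by rewrite opprK.
by case/eqP: gh; apply: enum_rank_inj; apply: val_inj.
Qed.

Lemma ksgnU g h G : h \notin G -> ksgn g (h |: G) = inv_sign g h * ksgn g G.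
Proof. by move=> hG; rewrite /ksgn big_setU1. Qed.

Lemma ksgn_sqr g G : ksgn g G * ksgn g G = 1.
Proof.
rewrite /ksgn -big_split big1 //= => h _; rewrite /inv_sign.
by case: ifP; rewrite ?mulrNN mulr1.
Qed.

Lemma ksgn_anticomm g h G : g != h -> g \notin G -> h \notin G ->
  ksgn g G * ksgn h (g |: G) = - (ksgn h G * ksgn g (h |: G)).
Proof.
move=> gh gG hG; rewrite !ksgnU // (inv_signC gh) mulNr mulrN opprK.
by rewrite [RHS]mulrC [LHS]mulrCA mulrA.
Qed.

(** A cochain v assigns a coefficient to the pairs (F, G) with F a face and G a
    set disjoint from F. The operator moves one element g out of G; the weight a
    decides what becomes of g. If g is put into F the weight is -1; if g becomes
    a factor of the coefficient it is the variable of g, or 1 once a multidegree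
    has been fixed. The term of g then reads the coefficient at
    (F :\ g, g |: G), and F :\ g is F itself when g is not in F. *)
Definition kdiff (a : T -> {set T} -> R) v F G : R :=
  \sum_(g | g \notin G) ksgn g G * a g F * v (F :\ g) (g |: G).

Lemma kdiffB a v w F G :
  kdiff a (fun F' G' => v F' G' - w F' G') F G = kdiff a v F G - kdiff a w F G.
Proof. by rewrite /kdiff -sumrB; apply: eq_bigr => g _; rewrite mulrBr. Qed.

(** Pairing the terms (i, j) and (j, i), rather than deducing 2 * x = 0, keeps
    characteristic 2 within reach. *)
Lemma antisym_sum0 (I : finType) (t : I -> I -> R) :
  (forall i, t i i = 0) -> (forall i j, t i j = - t j i) ->
  \sum_i \sum_j t i j = 0.
Proof.
move=> t0 tN.
have split_lt : \sum_i \sum_j t i j =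
    \sum_i \sum_(j | (enum_rank i < enum_rank j)%N) t i j +
    \sum_i \sum_(j | (enum_rank j < enum_rank i)%N) t i j.
  rewrite -big_split; apply: eq_bigr => i _ /=.
  rewrite (bigID (fun j => (enum_rank i < enum_rank j)%N)) /=; congr (_ + _).
  rewrite (bigD1 i) ?ltnn //= t0 add0r; apply: eq_bigl => j.
  rewrite -leqNgt ltn_neqAle andbC; congr (_ && _).
  by rewrite (inj_eq val_inj) (inj_eq enum_rank_inj).
rewrite split_lt [X in _ + X](exchange_big_dep predT) //= -big_split big1 //= => i _.
by rewrite -big_split big1 //= => j _; rewrite tN addNr.
Qed.

(** The weight of g does not see whether another element h is in F, so the terms
    that remove g then h and h then g differ only in their signs. *)
Lemma kdiff_sqr a v F G : (forall g h F', g != h -> a g (F' :\ h) = a g F') ->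
  kdiff a (kdiff a v) F G = 0.
Proof.
move=> aD.
pose t g h := if [&& g \notin G, h \notin G & g != h]
  then ksgn g G * a g F * (ksgn h (g |: G) * a h F * v (F :\ g :\ h) (h |: (g |: G)))
  else 0.
transitivity (\sum_g \sum_h t g h).
  rewrite /kdiff big_mkcond; apply: eq_bigr => g _; rewrite /t.
  case: ifP => gG; last by rewrite big1.
  rewrite mulr_sumr big_mkcond; apply: eq_bigr => h _.
  rewrite !inE negb_or andbC [h == g]eq_sym.
  by case: ifP => // /andP[hG gh]; rewrite aD // eq_sym.
apply: antisym_sum0 => [g|g h]; first by rewrite /t eqxx !andbF.
rewrite /t [h == g]eq_sym andbCA; case: ifP => [/and3P[hG gG gh]|_]; last by rewrite oppr0.
have -> : F :\ h :\ g = F :\ g :\ h by rewrite !setDDl [_ |: [set _]]setUC.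
rewrite [g |: (h |: G)]setUCA.
set V := v _ _; set x := ksgn g G; set y := ksgn h (g |: G).
have -> : x * a g F * (y * a h F * V) = (x * y) * (a g F * a h F * V).
  by rewrite -!mulrA; congr (_ * _); rewrite mulrCA.
rewrite /x /y ksgn_anticomm // mulNr; congr (- _).
rewrite -!mulrA; congr (_ * _); rewrite [RHS]mulrCA; congr (_ * _).
by rewrite mulrCA.
Qed.

End KoszulSums.

(** * Acyclicity in one multidegree *)

Definition complex_closed (T : finType) (Sigma : {set {set T}}) :=
  forall F F' : {set T}, F' \subset F -> F \in Sigma -> F' \in Sigma.

Section Cell.
Variables (T : finType) (R : comNzRingType).
Implicit Types (F G A : {set T}) (g h x : T) (v w u : {set T} -> {set T} -> R).

(** The form of anticommutation in which x has already been moved into G. *)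
Lemma ksgn_swap g x G : g != x -> g \notin G -> x \notin G ->
  ksgn R g (x |: G) * ksgn R x (g |: G) = - (ksgn R x G * ksgn R g G).
Proof.
move=> gx gG xG.
have /(congr1 (fun z => ksgn R x G * (z * ksgn R x (g |: G)))) := ksgn_anticomm R gx gG xG.
rewrite mulNr -mulrA ksgn_sqr mulr1 mulrN !mulrA ksgn_sqr mul1r => ->.
by rewrite opprK.
Qed.

Variables (Sigma : {set {set T}}) (A : {set T}).
Hypothesis SigmaC : complex_closed Sigma.

Definition cell_weight g F : R :=
  if g \in A then (if g \in F then -1 else 1) else 0.

Definition in_cell F G :=
  [&& F \in Sigma, [disjoint F & G], F \subset A & G \subset A].

Lemma cell_weightD g h F : g != h -> cell_weight g (F :\ h) = cell_weight g F.
Proof. by move=> gh; rewrite /cell_weight !inE gh. Qed.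

Lemma setD1_id x F : x \notin F -> F :\ x = F.
Proof. by move=> xF; apply/setDidPl; rewrite disjoint_sym disjoints1. Qed.

Lemma disjoint_move F G g : [disjoint F & G] -> [disjoint F :\ g & g |: G].
Proof.
rewrite -!setI_eq0 => /eqP FG; apply/eqP/setP => y; rewrite !inE.
by move/setP/(_ y): FG; rewrite !inE; case: (y == g); case: (y \in F).
Qed.

Lemma in_cell_move F G g : in_cell F G -> g \in A -> in_cell (F :\ g) (g |: G).
Proof.
case/and4P=> FS FG FA GA gA; apply/and4P; split.
- by apply: SigmaC FS; apply: subD1set.
- exact: disjoint_move.
- by apply: subset_trans FA; apply: subD1set.
- by rewrite subUset sub1set gA.
Qed.

(** In multidegree A the pairs (F, G) with a fixed F <> A are matched by moving
    some x in A :\: F in and out of G, so each layer of fixed F is contractible.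
    The operator also reads the cochain at smaller sets F; induction on #|F| deals
    with those terms.
    The only unmatched pair is (A, set0), which carries the class of the monomial
    of support A in K[Sigma]. *)
Lemma cell_acyclic u :
  (forall F G, in_cell F G -> kdiff cell_weight u F G = 0) ->
  exists w, forall F G, in_cell F G -> F != A -> u F G = kdiff cell_weight w F G.
Proof.
move=> u_cycle.
suff [w Hw] : exists w, forall F G, in_cell F G -> F != A -> (#|F| < #|T|.+1)%N ->
    u F G = kdiff cell_weight w F G.
  by exists w => F G FG FA; apply: Hw => //; rewrite ltnS max_card.
elim: (#|T|.+1) => [|s [w Hw]]; first by exists (fun _ _ => 0).
pose u' F G := u F G - kdiff cell_weight w F G.
have u'_cycle F G : in_cell F G -> kdiff cell_weight u' F G = 0.
  by move=> FG; rewrite kdiffB u_cycle // kdiff_sqr ?subr0 //; apply: cell_weightD.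
have u'_low F G : in_cell F G -> F != A -> (#|F| < s)%N -> u' F G = 0.
  by move=> FG FA Fs; rewrite /u' -Hw ?subrr.
(* Contraction of the layer #|F| = s: take x out of G when it is there. *)
pose w' F G := if [pick x in A :\: F] is Some x then
   if (#|F| == s) && (x \in G) then ksgn R x (G :\ x) * u' F (G :\ x) else 0 else 0.
suff Hw' F G : in_cell F G -> F != A -> (#|F| < s.+1)%N ->
    kdiff cell_weight w' F G = u' F G.
  exists (fun F G => w F G - - w' F G) => F G FG FA Fs.
  rewrite kdiffB -[LHS](subrK (kdiff cell_weight w F G)) -/(u' F G) -Hw' // addrC.
  congr (_ + _); rewrite /kdiff -sumrN; apply: eq_bigr => g _.
  by rewrite mulrN opprK.
move=> FG FA; have /and4P[FS dFG sFA sGA] := FG.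
rewrite ltnS leq_eqVlt => /orP[Fs|Fs]; last first.
  rewrite u'_low //; apply: big1 => g gG; rewrite /w'.
  case: pickP => [x _|_]; last by rewrite mulr0.
  rewrite ltn_eqF ?mulr0 //; apply: leq_ltn_trans Fs.
  exact/subset_leq_card/subD1set.
have F_small g : g \in F -> (#|F :\ g| < s)%N.
  by move=> gF; rewrite -(eqP Fs) [X in (_ < X)%N](cardsD1 g) gF.
have w'E g : kdiff cell_weight w' F G =
    \sum_(g in A | (g \notin F) && (g \notin G)) ksgn R g G * w' F (g |: G).
  rewrite /kdiff big_mkcond [RHS]big_mkcond; apply: eq_bigr => {}g _ /=.
  case gG: (g \in G) => /=; first by rewrite !andbF.
  rewrite /cell_weight; case gA: (g \in A) => /=; last by rewrite mulr0 mul0r.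
  case gF: (g \in F) => /=; last by rewrite mulr1 setD1_id ?gF.
  have /F_small lt := gF.
  by rewrite /w'; case: pickP => [x _|_]; rewrite ?(ltn_eqF lt) mulr0.
have [x xA'] : exists x, x \in A :\: F.
  apply/set0Pn; rewrite setD_eq0; apply: contra FA => AF.
  by rewrite eqEsubset sFA.
rewrite {}w'E // /w'.
case: pickP => [{xA'}x|/(_ x)]; last by rewrite /= xA'.
rewrite inE => /andP[xF xA]; rewrite Fs /=.
case xG: (x \in G); last first.
  rewrite (bigD1 x) /= ?xA ?xF ?xG // setU11 setU1K ?xG // mulrA ksgn_sqr mul1r.
  rewrite big1 ?addr0 // => g /andP[/and3P[gA gF gG] gx].
  by rewrite !inE [x == g]eq_sym (negPf gx) xG mulr0.
pose G0 := G :\ x; have GE : G = x |: G0 by rewrite setD1K.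
have xG0 : x \notin G0 by rewrite !inE eqxx.
have FG0 : in_cell F G0.
  apply/and4P; split=> //; last by apply: subset_trans sGA; apply: subD1set.
  by apply: disjointWr dFG; apply: subD1set.
have := u'_cycle _ _ FG0; rewrite /kdiff (bigD1 x) //= /cell_weight xA (negPf xF).
rewrite mulr1 setD1_id // -GE => /eqP; rewrite addr_eq0 => /eqP cyc.
transitivity (ksgn R x G0 * (ksgn R x G0 * u' F G)); last first.
  by rewrite mulrA ksgn_sqr mul1r.
rewrite {}cyc mulrN mulr_sumr -sumrN.
rewrite big_mkcond [RHS]big_mkcond; apply: eq_bigr => g _ /=.
rewrite {1 2}GE in_setU1; case: (eqVneq g x) => [->|gx] /=; first by rewrite !andbF.
rewrite andbT; case gG0: (g \in G0) => /=; first by rewrite !andbF.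
have xgG : (g |: G) :\ x = g |: G0.
  by rewrite GE setUCA setU1K // in_setU1 negb_or xG0 eq_sym gx.
rewrite !inE xG orbT xgG.
case gA: (g \in A) => /=; last by rewrite mulr0 mul0r mulr0 oppr0.
case gF: (g \in F) => /=.
  rewrite u'_low ?mulr0 ?oppr0 //; first exact: in_cell_move.
    by apply: contra FA => /eqP E; rewrite eqEsubset sFA -E subD1set.
  exact: F_small.
by rewrite mulr1 setD1_id ?gF // mulrA ksgn_swap ?gG0 // mulNr mulrA.
Qed.

End Cell.

(** * Monomials and membership in the Stanley-Reisner ideal *)

Section Monomials.
Variables (n : nat) (K : fieldType).

(** Coefficient form of multiplication by a monomial, with no divisibility assumed. *)
Lemma mcoeffMX_if (p : {mpoly K[n]}) (m k : 'X_{1..n}) :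
  (p * 'X_[m])@_k = if (m <= k)%MM then p@_(k - m) else 0.
Proof.
case: ifP => mk; first by rewrite -{1}(submK mk) addmC mcoeffMX.
apply/eqP; rewrite mcoeff_eq0; apply: contraFN mk.
rewrite (perm_mem (msuppMX _ _)) => /mapP[m' _ ->].
by apply/mnm_lepP => i; rewrite mnmDE leq_addr.
Qed.

End Monomials.

Section SquarefreeMonomials.
Variables (K : fieldType) (T : finType).
Local Notation n := #|T|.
Implicit Types (F G A : {set T}) (g h x : T) (m a : 'X_{1..n}).

Definition setm A : 'X_{1..n} := [multinom nat_of_bool (enum_val i \in A) | i < n].

Definition msupport m : {set T} := [set x | m (enum_rank x) != 0%N].

Lemma setmE A x : setm A (enum_rank x) = (x \in A).
Proof. by rewrite mnmE enum_rankK. Qed.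

Lemma mnm_eq_rank m m' : (forall x, m (enum_rank x) = m' (enum_rank x)) -> m = m'.
Proof. by move=> E; apply/mnmP => i; rewrite -(enum_valK i) E. Qed.

Lemma setm_le A m : (setm A <= m)%MM = (A \subset msupport m).
Proof.
apply/mnm_lepP/subsetP => [H x xA|H i].
  by rewrite inE -lt0n (leq_trans _ (H _)) // setmE xA.
rewrite -(enum_valK i) setmE; case: (boolP (_ \in A)) => // /H.
by rewrite inE lt0n.
Qed.

Lemma mdeg_setm A : mdeg (setm A) = #|A|.
Proof.
rewrite mdegE (reindex enum_rank) /=; last first.
  by apply: onW_bij; apply: enum_rank_bij.
by rewrite -[RHS]sum1_card [RHS]big_mkcond; apply: eq_bigr => x _; rewrite setmE; case: (x \in A).
Qed.

Lemma setmU1 g A : g \notin A -> setm (g |: A) = (setm A + U_(enum_rank g))%MM.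
Proof.
move=> gA; apply: mnm_eq_rank => x; rewrite mnmDE !setmE mnm1E in_setU1.
rewrite (inj_eq enum_rank_inj) [g == x]eq_sym; case: eqVneq => [->|_] /=; last by rewrite addn0.
by rewrite (negPf gA).
Qed.

Lemma set_monoE A : set_mono K A = 'X_[setm A].
Proof.
have [k] := ubnP #|A|; elim: k A => // k IH A; rewrite ltnS => Ak.
case: (set_0Vmem A) => [->|[x xA]].
  rewrite /set_mono big_set0; have -> : setm set0 = 0%MM; last by rewrite mpolyX0.
  by apply: mnm_eq_rank => x; rewrite setmE mnm0E inE.
rewrite /set_mono (big_setD1 x) //= -/(set_mono K (A :\ x)) IH; last first.
  by apply: leq_trans Ak; rewrite [X in (_ < X)%N](cardsD1 x) xA.
by rewrite -mpolyXD addmC -setmU1 ?setD1K // !inE eqxx.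
Qed.

Lemma msupport_add m m' : msupport (m + m')%MM = msupport m :|: msupport m'.
Proof. by apply/setP => y; rewrite !inE mnmDE addn_eq0 negb_and. Qed.

Lemma msupport_setm A : msupport (setm A) = A.
Proof. by apply/setP => y; rewrite !inE setmE; case: (y \in A). Qed.

Variable (Sigma : {set {set T}}).
Hypothesis SigmaC : complex_closed Sigma.

(** Grouping the monomials of p by their support A gives the coefficient of the
    generator of A. *)
Lemma sr_idealP (p : sring K T) :
  sr_ideal Sigma p <-> (forall m, p@_m != 0 -> msupport m \notin Sigma).
Proof.
split=> [[c ->] m|H].
  rewrite raddf_sum /=; apply: contraNN => mS; apply/eqP; apply: big1 => A AS.
  rewrite set_monoE mcoeffMX_if setm_le ifN //; apply: contra AS => AS.
  exact: SigmaC mS.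
exists (fun A => \sum_(m <- msupp p | msupport m == A) p@_m *: 'X_[m - setm A]).
transitivity (\sum_(A | A \notin Sigma)
    \sum_(m <- msupp p | msupport m == A) p@_m *: 'X_[m]).
  rewrite (exchange_big_dep predT) //= {1}(mpolyE p) big_seq_cond [RHS]big_seq_cond.
  apply: eq_bigr => m /andP[mp _]; rewrite (big_pred1 (msupport m)) // => A /=.
  rewrite andbC eq_sym; case: eqP => //= ->.
  by rewrite H // -mcoeff_msupp.
apply: eq_bigr => A _; rewrite mulr_suml; apply: eq_bigr => m /eqP mA.
by rewrite set_monoE -scalerAl -mpolyXD submK // setm_le mA.
Qed.

End SquarefreeMonomials.

(** * Acyclicity over the polynomial ring *)

Section PolyExact.
Variables (K : fieldType) (T : finType).
Local Notation n := #|T|.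
Local Notation R := {mpoly K[n]}.
Implicit Types (F G A : {set T}) (g h x : T) (m a : 'X_{1..n}).
Implicit Types (v w : {set T} -> {set T} -> R).

Definition poly_weight g F : R := if g \in F then -1 else 'X_(enum_rank g).

Lemma poly_weightD g h F : g != h -> poly_weight g (F :\ h) = poly_weight g F.
Proof. by move=> gh; rewrite /poly_weight !inE gh. Qed.

Lemma ksgn_mpolyC g G : ksgn R g G = (ksgn K g G)%:MP.
Proof.
rewrite /ksgn rmorph_prod; apply: eq_bigr => h _; rewrite /inv_sign.
by case: ifP => _; rewrite ?rmorphN rmorph1.
Qed.

Variable (Sigma : {set {set T}}).
Hypothesis SigmaC : complex_closed Sigma.

(** The piece of v in multidegree a: the basis element of (F, G) has the squarefree
    multidegree of F :|: G, so its coefficient contributes the monomial of a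
    divided by that squarefree one. *)
Definition part v a F G : K :=
  if F :|: G \subset msupport a then (v F G)@_(a - setm (F :|: G)) else 0.

Definition face_pair F G := (F \in Sigma) && [disjoint F & G].

Lemma in_cellE A F G :
  in_cell Sigma A F G = face_pair F G && (F :|: G \subset A).
Proof. by rewrite /in_cell /face_pair subUset !andbA. Qed.

(** Multiplication by the variable of g turns into the weight 1 on the elements of
    the support of a. *)
Lemma part_kdiff v a F G : in_cell Sigma (msupport a) F G ->
  part (kdiff poly_weight v) a F G = kdiff (cell_weight K (msupport a)) (part v a) F G.
Proof.
move=> FG; have := FG; rewrite in_cellE => /andP[/andP[FS dFG] sFGA].
rewrite {1}/part sFGA /kdiff raddf_sum /=; apply: eq_bigr => g gG.
rewrite ksgn_mpolyC -!mulrA mcoeffCM; congr (_ * _).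
rewrite /poly_weight /cell_weight /part; case: (boolP (g \in F)) => gF.
  have UE : F :\ g :|: (g |: G) = F :|: G by rewrite setUCA setUA setD1K.
  have -> : g \in msupport a by move/subsetP: sFGA; apply; rewrite inE gF.
  by rewrite UE sFGA !mulN1r mcoeffN.
rewrite setD1_id // setUCA subUset sub1set sFGA andbT.
rewrite mulrC mcoeffMX_if setmU1 ?inE ?negb_or ?gF //.
have -> : (U_(enum_rank g) <= a - setm (F :|: G))%MM = (g \in msupport a).
  apply/mnm_lepP/idP => [/(_ (enum_rank g))|gA x].
    rewrite mnm1E eqxx mnmBE setmE inE (negPf gF) (negPf gG) subn0 inE.
    by rewrite lt0n.
  rewrite mnm1E; case: eqP => // <-.
  by rewrite mnmBE setmE inE (negPf gF) (negPf gG) subn0 lt0n; rewrite inE in gA.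
rewrite inE; case: ifP => _; by rewrite ?mul0r ?mul1r ?submDA.
Qed.

Lemma eq_kdiff (S : comNzRingType) (wt : T -> {set T} -> S) u u' F G :
  (forall g, g \notin G -> wt g F != 0 -> u (F :\ g) (g |: G) = u' (F :\ g) (g |: G)) ->
  kdiff wt u F G = kdiff wt u' F G.
Proof.
move=> E; apply: eq_bigr => g gG; case: (eqVneq (wt g F) 0) => [->|wg].
  by rewrite mulr0 !mul0r.
by rewrite E.
Qed.

Lemma cell_weight_neq0 A g F : cell_weight K A g F != 0 -> g \in A.
Proof. by rewrite /cell_weight; case: (g \in A) => //; rewrite eqxx. Qed.

Lemma part_large v : exists B, forall a F G, (B <= mdeg a)%N -> part v a F G = 0.
Proof.
exists (\sum_(p : {set T} * {set T}) msize (v p.1 p.2) + n)%N => a F G Ba.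
rewrite /part; case: ifP => // FGa; apply/eqP; rewrite mcoeff_eq0.
apply: msize_mdeg_ge; rewrite -(leq_add2r n).
apply: leq_trans (leq_trans _ Ba) _.
  by rewrite leq_add2r (bigD1 (F, G)) //= leq_addr.
rewrite -{1}(submK (m' := a) (m := setm (F :|: G))) ?setm_le //.
by rewrite mdegD leq_add2l mdeg_setm max_card.
Qed.

(** A family of pieces comes from polynomials as soon as it is bounded in degree. *)
Lemma part_surj (B : nat) (wa : 'X_{1..n} -> {set T} -> {set T} -> K) :
  (forall a F G, (B <= mdeg a)%N -> wa a F G = 0) ->
  exists w, forall a F G, F :|: G \subset msupport a -> part w a F G = wa a F G.
Proof.
move=> wa0.
exists (fun F G => \sum_(m : 'X_{1..n < B}) wa (m + setm (F :|: G))%MM F G *: 'X_[m]).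
move=> a F G sFG; rewrite /part sFG.
case: (ltnP (mdeg a) B) => aB.
  rewrite (mcoeff_mpoly (fun m => wa (m + setm (F :|: G))%MM F G)).
    by rewrite submK // setm_le.
  exact: leq_ltn_trans (mdegB _ _) aB.
rewrite wa0 // raddf_sum big1 //= => m _; rewrite mcoeffZ mcoeffX.
case: eqP => [E|_]; last by rewrite mulr0.
by rewrite E submK ?setm_le // wa0 // mul0r.
Qed.

(** The operator is homogeneous for the fine grading, so a cycle can be bounded one
    multidegree at a time; only finitely many multidegrees occur in it. *)
Lemma poly_acyclic v :
  (forall F G, face_pair F G -> kdiff poly_weight v F G = 0) ->
  exists w, forall a F G, in_cell Sigma (msupport a) F G -> F != msupport a ->
    part v a F G = part (kdiff poly_weight w) a F G.
Proof.
move=> v_cycle; have [B vB] := part_large v.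
have cell_bd (a : 'X_{1..n < B}) : exists wa : {set T} -> {set T} -> K,
    forall F G, in_cell Sigma (msupport a) F G -> F != msupport a ->
      part v a F G = kdiff (cell_weight K (msupport a)) wa F G.
  apply: (cell_acyclic SigmaC) => F G FG; rewrite -part_kdiff //.
  have := FG; rewrite in_cellE => /andP[FGr _].
  by rewrite /part v_cycle // mcoeff0 if_same.
have [wb Hwb] := fin_all_exists cell_bd.
pose wa (a : 'X_{1..n}) F G := oapp (fun a' : 'X_{1..n < B} => wb a' F G) 0 (insub a).
have [|w Hw] := part_surj (B := B) (wa := wa).
  by move=> a F G aB; rewrite /wa insubN // -leqNgt.
exists w => a F G FG FA; rewrite part_kdiff //.
rewrite (eq_kdiff (u' := wa a)); last first.
  move=> g gG /cell_weight_neq0 gA; apply: Hw.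
  by have := in_cell_move SigmaC FG gA; rewrite in_cellE => /andP[].
case: (ltnP (mdeg a) B) => aB.
  rewrite (Hwb (Sub a aB)) ?SubK //.
  by apply: eq_bigr => g _; rewrite /wa insubT.
rewrite vB // /kdiff big1 // => g _.
by rewrite /wa insubN ?mulr0 // -leqNgt.
Qed.

End PolyExact.

(** * A free resolution of the Stanley-Reisner ring *)

(** A minimal free resolution with minimality dropped: the resolution built
    below is explicit but far from minimal. *)
Record free_resolution (K : fieldType) (n : nat) (I : {mpoly K[n]} -> Prop)
    (F : free_seq K n) : Prop := FreeResolution {
  fr_aug_graded : graded_mx (@gdeg K n F 0) (fun _ : 'I_1 => 0%N) (gaug F);
  fr_diff_graded :
    forall i, graded_mx (@gdeg K n F i.+1) (@gdeg K n F i) (gdiff F i);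
  fr_aug_surj :
    forall p : {mpoly K[n]},
      exists v : 'rV_(grank F 0), I (p - (v *m gaug F) 0 0);
  fr_exact0 :
    forall v : 'rV_(grank F 0),
      I ((v *m gaug F) 0 0) <-> exists w, v = w *m gdiff F 0;
  fr_exactS :
    forall i (v : 'rV_(grank F i.+1)),
      v *m gdiff F i = 0 <-> exists w, v = w *m gdiff F i.+1
}.

Section DiffCoef.
Variables (T : finType) (R : comNzRingType).
Implicit Types (F G : {set T}) (p q : {set T} * {set T}) (A B : {set {set T} * {set T}}).

Definition diff_coef (wt : T -> {set T} -> R) p q : R :=
  \sum_(g | g \notin q.2)
    (if p == (q.1 :\ g, g |: q.2) then ksgn R g q.2 * wt g q.1 else 0).

Definition curried (f : {set T} * {set T} -> R) F G := f (F, G).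

Lemma mul_row_diff A B wt (v : 'rV_#|A|) :
  v *m smx A B (diff_coef wt) = restr B (fun q => kdiff wt (curried (zext v)) q.1 q.2).
Proof.
rewrite mul_row_smx; apply: eq_restr => q _.
under eq_bigr => p _ do rewrite mulr_sumr.
rewrite exchange_big /=; apply: eq_bigr => g _.
set p0 := (_, _); rewrite /curried -/p0.
rewrite (eq_bigr (fun p => if p == p0 then ksgn R g q.2 * wt g q.1 * zext v p else 0)).
  rewrite -big_mkcondr /=; case: (boolP (p0 \in A)) => p0A.
    rewrite (big_pred1 p0) // => p /=; case: eqP => [->|]; by rewrite ?p0A ?andbF.
  rewrite zext_out // mulr0 big1 // => p /andP[pA /eqP pp0].
  by rewrite -pp0 pA in p0A.
by move=> p _; case: eqP => _; rewrite ?mulr0 // mulrC.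
Qed.

Lemma diff_coef_move wt F G g : g \notin G ->
  diff_coef wt (F :\ g, g |: G) (F, G) = ksgn R g G * wt g F.
Proof.
move=> gG; rewrite /diff_coef (bigD1 g) //= eqxx big1 ?addr0 // => h /andP[hG hg].
case: eqP => // -[_ /setP/(_ g)]; rewrite !inE eqxx /= (negPf gG) orbF => /esym/eqP gh.
by rewrite gh eqxx in hg.
Qed.

Lemma diff_coef_neq0 wt p q : diff_coef wt p q != 0 ->
  exists2 g, g \notin q.2 & p = (q.1 :\ g, g |: q.2).
Proof.
move=> nz; case: (pickP (fun g => (g \notin q.2) && (p == (q.1 :\ g, g |: q.2)))).
  by move=> g /andP[gG /eqP E]; exists g.
move=> no; case/eqP: nz; apply: big1 => g gG.
by have := no g; rewrite gG /= => ->.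
Qed.

End DiffCoef.

Section KoszulResolution.
Variables (K : fieldType) (T : finType) (Sigma : {set {set T}}).
Hypotheses (SigmaC : complex_closed Sigma) (Sigma0 : set0 \in Sigma).
Local Notation n := #|T|.
Local Notation R := {mpoly K[n]}.
Implicit Types (F G A : {set T}) (g h x : T) (m a : 'X_{1..n}).

Definition pair_basis i : {set {set T} * {set T}} :=
  [set p | face_pair Sigma p.1 p.2 && (#|p.2| == i)].

Definition pair_deg (p : {set T} * {set T}) := (#|p.1| + #|p.2|)%N.

(** In degree i the basis consists of the pairs (F, G) with F a face, G disjoint
    from F and #|G| = i. Filtered by F, it is a sum of Koszul complexes on the
    variables outside F, which resolve the pieces x^F K[x : x in F] of K[Sigma]. *)
Definition sr_resolution : free_seq K n :=
  @FreeSeq K n (fun i => #|pair_basis i|) (fun i b => pair_deg (enum_val b))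
    (\col_b 'X_[setm (enum_val b).1])
    (fun i => smx (pair_basis i.+1) (pair_basis i) (diff_coef (@poly_weight K T))).

Lemma pair_basis_move i F G g : (F, G) \in pair_basis i -> g \notin G ->
  (F :\ g, g |: G) \in pair_basis i.+1.
Proof.
rewrite !inE /= => /andP[/andP[FS FG] /eqP <-] gG.
rewrite /face_pair (SigmaC _ FS) ?subD1set // disjoint_move //=.
by rewrite cardsU1 gG.
Qed.

Lemma kdiff_outside i (v : 'rV[R]_#|pair_basis i|) (wt : T -> {set T} -> R) F G :
  #|G|.+1 != i -> kdiff wt (curried (zext v)) F G = 0.
Proof.
move=> Gi; apply: big1 => g gG; rewrite /curried zext_out ?mulr0 //.
by rewrite !inE /= cardsU1 gG (negPf Gi) andbF.
Qed.

Lemma kdiff_zext_restr i (w : {set T} -> {set T} -> R) (wt : T -> {set T} -> R) F G :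
  (F, G) \in pair_basis i ->
  kdiff wt (curried (zext (restr (pair_basis i.+1) (fun q => w q.1 q.2)))) F G
    = kdiff wt w F G.
Proof.
move=> FG; apply: eq_kdiff => g gG _.
by rewrite /curried zext_restr ?pair_basis_move.
Qed.

Lemma part_at (v : {set T} -> {set T} -> R) F G m :
  part v (m + setm (F :|: G))%MM F G = (v F G)@_m.
Proof. by rewrite /part msupport_add msupport_setm subsetUr addmK. Qed.

Lemma in_cell_at F G m : face_pair Sigma F G ->
  in_cell Sigma (msupport (m + setm (F :|: G))%MM) F G.
Proof. by move=> FG; rewrite in_cellE FG msupport_add msupport_setm subsetUr. Qed.

Lemma sr_resolution_exactS i (v : 'rV_(grank sr_resolution i.+1)) :
  v *m gdiff sr_resolution i = 0 <-> exists w, v = w *m gdiff sr_resolution i.+1.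
Proof.
rewrite /= in v *; split=> [|[w ->]].
  rewrite mul_row_diff => v_cycle.
  have [F G FG|w Hw] := poly_acyclic SigmaC (v := curried (zext v)).
    have [Gi|Gi] := eqVneq #|G| i; last exact: kdiff_outside.
    have FGi : (F, G) \in pair_basis i by rewrite inE FG Gi eqxx.
    have [b E] := set_enum_val FGi.
    by have /rowP/(_ b) := v_cycle; rewrite !mxE -E.
  exists (restr (pair_basis i.+2) (fun q => w q.1 q.2)).
  rewrite mul_row_diff -[v in LHS]restr_zext; apply: eq_restr => -[F G] FG /=.
  rewrite kdiff_zext_restr //; apply/mpolyP => m.
  have FGr : face_pair Sigma F G by move: FG; rewrite inE => /andP[].
  have := Hw (m + setm (F :|: G))%MM F G; rewrite !part_at; apply.
    exact: in_cell_at.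
  have [g gG] : exists g, g \in G.
    by apply/set0Pn; rewrite -card_gt0; move: FG; rewrite inE => /andP[_ /eqP ->].
  have dFG : [disjoint F & G] by case/andP: FGr.
  apply/eqP => FA; have := disjointFl dFG gG.
  by rewrite {1}FA msupport_add msupport_setm !inE gG !orbT.
rewrite mul_row_diff; apply/rowP => b; rewrite !mxE mul_row_diff.
have := enum_valP b; case: (enum_val b) => F G FG /=.
rewrite (@kdiff_zext_restr _ (kdiff (@poly_weight K T) (curried (zext w)))) //.
by rewrite kdiff_sqr //; apply: poly_weightD.
Qed.

(** The augmentation kills boundaries: in multidegree A the value taken from {g}
    occurs once with g joining F and once with g joining the coefficient. *)
Lemma sum_cell_kdiff A (u : {set T} -> {set T} -> K) :
  \sum_(F : {set T} | F \subset A) kdiff (cell_weight K A) u F set0 = 0.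
Proof.
rewrite exchange_big big1 //= => g _.
case: (boolP (g \in A)) => gA; last first.
  by apply: big1 => F _; rewrite /cell_weight (negPf gA) mulr0 mul0r.
rewrite (bigID (fun F : {set T} => g \in F)) /=.
rewrite (reindex_onto (fun F => g |: F) (fun F => F :\ g)) /=; last first.
  by move=> F /andP[_ gF]; rewrite setD1K.
rewrite (eq_bigl (fun F : {set T} => (F \subset A) && (g \notin F))); last first.
  move=> F; rewrite subUset sub1set gA setU11 /= andbT; congr (_ && _).
  apply/eqP/idP => [<-|gF]; last by rewrite setU1K.
  by rewrite !inE eqxx.
rewrite -big_split big1 //= => F /andP[_ gF].
rewrite /cell_weight gA setU11 (negPf gF) setU1K // setD1_id //.
by rewrite mulr1 mulrN1 mulNr addNr.
Qed.

Lemma aug_coef (v : 'rV[R]_#|pair_basis 0|) a : msupport a \in Sigma ->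
  ((v *m gaug sr_resolution) 0 0)@_a =
    \sum_(F : {set T} | F \subset msupport a) part (curried (zext v)) a F set0.
Proof.
move=> aS; rewrite mxE raddf_sum /=.
pose f (p : {set T} * {set T}) : K :=
  if p.1 \subset msupport a then (zext v p)@_(a - setm p.1) else 0.
rewrite (eq_bigr (fun b => f (enum_val b))) => [|b _]; last first.
  by rewrite !mxE mcoeffMX_if setm_le -zext_val.
rewrite (big_enum_set _ f) /f.
rewrite -big_mkcondr /= (reindex_onto (fun F => (F, set0)) fst) /=.
  apply: eq_big => [F|F /andP[Fa _]].
    rewrite !inE /= eqxx andbT /face_pair cards0 eqxx andbT -setI_eq0 setI0 eqxx andbT.
    by case: (boolP (F \subset _)) => [/SigmaC->//|]; rewrite andbF.
  by move: Fa; rewrite /part setU0 => /andP[_ ->].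
by case=> F G; rewrite !inE /= cards_eq0 => /andP[/andP[_ /eqP ->]].
Qed.

(** Acyclicity leaves only the pairs (A, set0) with A a face. There the
    augmentation, which adds up all coefficients of multidegree A, detects the
    remaining one. *)
Lemma sr_resolution_exact0 (v : 'rV_(grank sr_resolution 0)) :
  sr_ideal Sigma ((v *m gaug sr_resolution) 0 0) <->
    exists w, v = w *m gdiff sr_resolution 0.
Proof.
have SC : complex_closed Sigma by [].
rewrite sr_idealP //; split=> [Iv|[w ->] m].
  rewrite /= in v Iv *.
  have [F G _|w Hw] := poly_acyclic SigmaC (v := curried (zext v)).
    exact: kdiff_outside.
  exists (restr (pair_basis 1) (fun q => w q.1 q.2)).
  rewrite mul_row_diff -[v in LHS]restr_zext; apply: eq_restr => -[F G] FG /=.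
  rewrite kdiff_zext_restr //; apply/mpolyP => m.
  have := FG; rewrite inE /= cards_eq0 => /andP[FGr /eqP G0].
  rewrite -[zext v _]/(curried (zext v) F G).
  pose a := (m + setm (F :|: G))%MM.
  suff : part (curried (zext v)) a F G = part (kdiff (@poly_weight K T) w) a F G.
    by rewrite /a !part_at.
  have [Fa|] := eqVneq F (msupport a); last by apply: Hw; apply: in_cell_at.
  have aS : msupport a \in Sigma by rewrite -Fa; case/andP: FGr.
  have cell F' : F' \subset msupport a -> in_cell Sigma (msupport a) F' set0.
    move=> F'a; rewrite /in_cell (SigmaC F'a) // F'a sub0set andbT.
    by rewrite -setI_eq0 setI0 eqxx.
  have vw F' : (F' \subset msupport a) && (F' != msupport a) ->
      part (curried (zext v)) a F' set0 = part (kdiff (@poly_weight K T) w) a F' set0.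
    by case/andP=> F'a F'na; apply: Hw => //; apply: cell.
  have := sum_cell_kdiff (msupport a) (part w a).
  have Iva : ((v *m gaug sr_resolution) 0 0)@_a = 0.
    by apply/eqP; apply: contraTT aS; apply: Iv.
  have := aug_coef v aS; rewrite {}Iva.
  rewrite (bigD1 (msupport a)) //= (eq_bigr _ vw) => /esym/eqP.
  rewrite addr_eq0 => /eqP vE.
  rewrite (eq_bigr (fun F' => part (kdiff (@poly_weight K T) w) a F' set0)); last first.
    by move=> F' F'a; rewrite (part_kdiff (Sigma := Sigma)) //; apply: cell.
  rewrite (bigD1 (msupport a)) //= => /eqP.
  by rewrite addr_eq0 => /eqP wE; rewrite G0 Fa vE wE.
rewrite /= in w *; apply: contraNN => mS; apply/eqP; rewrite aug_coef //.
rewrite -[RHS](sum_cell_kdiff (msupport m) (part (curried (zext w)) m)).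
apply: eq_bigr => F Fm.
have F0 : (F, set0) \in pair_basis 0.
  rewrite inE /= cards0 eqxx andbT /face_pair (SigmaC Fm) //.
  by rewrite -setI_eq0 setI0 eqxx.
rewrite -(part_kdiff (Sigma := Sigma)).
  by rewrite /part /curried mul_row_diff zext_restr.
by rewrite in_cellE setU0 Fm andbT; move: F0; rewrite inE => /andP[].
Qed.

Lemma sr_resolution_free : free_resolution (@sr_ideal K T Sigma) sr_resolution.
Proof.
split.
- move=> b c /=; rewrite mxE => _; split=> //.
  have := enum_valP b; rewrite inE => /andP[_ /eqP G0].
  by rewrite subn0 /pair_deg G0 addn0 dhomogX /= mdeg_setm.
- move=> i b c; rewrite mxE /gdeg /=.
  case/diff_coef_neq0 => g; case: (enum_val c) => F G /= gG ->.
  rewrite diff_coef_move // /pair_deg /= cardsU1 gG ksgn_mpolyC mul_mpolyC.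
  rewrite /poly_weight [in #|F|](cardsD1 g); case: (boolP (g \in F)) => gF /=.
    rewrite addnCA leqnn subnn; split=> //; apply: dhomogZ.
    by rewrite dhomogN; apply: dhomog1.
  rewrite add0n leq_add2l leqnSn subnDl subSnn; split=> //; apply: dhomogZ.
  by rewrite dhomogX /= mdeg1.
- move=> p; pose f (q : {set T} * {set T}) := if q == (set0, set0) then p else 0.
  exists (restr (pair_basis 0) f).
  suff -> : (restr (pair_basis 0) f *m gaug sr_resolution) 0 0 = p.
    by rewrite subrr; apply/sr_idealP => // m; rewrite mcoeff0 eqxx.
  have b0 : (set0, set0) \in pair_basis 0.
    by rewrite inE /face_pair /= Sigma0 cards0 eqxx -setI_eq0 setI0 eqxx.
  rewrite mxE (eq_bigr (fun b => f (enum_val b) * 'X_[setm (enum_val b).1])); last first.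
    by move=> b _; rewrite !mxE.
  rewrite (big_enum_set (pair_basis 0) (fun q => f q * 'X_[setm q.1])) /f.
  rewrite (bigD1 (set0, set0)) //= eqxx big1 => [|q /andP[_ /negPf->]]; last first.
    by rewrite mul0r.
  rewrite addr0 (_ : setm set0 = 0%MM) ?mpolyX0 ?mulr1 //.
  by apply: mnm_eq_rank => x; rewrite setmE mnm0E inE.
- exact: sr_resolution_exact0.
- exact: sr_resolution_exactS.
Qed.

End KoszulResolution.

(** * Comparison of a minimal and an arbitrary free resolution *)

Section RankIdentity.
Variable K : fieldType.

(** If phi embeds a complex with zero differential as a homotopy retract of
    another complex, then at each spot the cycles are the direct sum of the image
    of phi and of the boundaries. The idempotents D restrict this to a degree. *)
Lemma homology_rank f g g' h (phi : 'M[K]_(f, g)) (psi : 'M_(g, f))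
    (d : 'M_(g', g)) (c : 'M_(g, h)) (s : 'M_(g, g')) (t : 'M_(h, g))
    (Df : 'M_f) (D : 'M_g) (D' : 'M_g') :
  phi *m psi = 1%:M -> psi *m phi = 1%:M + s *m d + c *m t ->
  phi *m c = 0 -> d *m c = 0 -> d *m psi = 0 ->
  Df *m phi = phi *m D -> D' *m d = d *m D -> D *m D = D ->
  (\rank Df + \rank (D' *m d) + \rank (D *m c) = \rank D)%N.
Proof.
move=> pp1 pp2 pc dc dp Dp Dd DD.
rewrite -[RHS](mxrank_mul_ker _ c) [RHS]addnC; congr (_ + _)%N.
have free_phi : row_free phi by apply/row_freeP; exists psi.
rewrite -(mxrankMfree Df free_phi).
have capE : (Df *m phi :&: D' *m d = 0)%MS.
  apply/eqP; rewrite -submx0; apply/rV_subP => v; rewrite sub_capmx.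
  case/andP=> /submxP[x vx] /submxP[y vy].
  have xD0 : x *m Df = 0.
    by rewrite -[x *m Df]mulmx1 -pp1 !mulmxA -(mulmxA x) -vx vy -!mulmxA dp !mulmx0.
  by rewrite vx mulmxA xD0 mul0mx sub0mx.
rewrite -mxrank_disjoint_sum //.
apply: eqmx_rank; apply/andP; split.
  rewrite addsmx_sub !sub_capmx; apply/andP; split; apply/andP; split.
  - by rewrite Dp submxMl.
  - by apply/sub_kermxP; rewrite -mulmxA pc mulmx0.
  - by rewrite Dd submxMl.
  - by apply/sub_kermxP; rewrite -mulmxA dc mulmx0.
apply/rV_subP => v; rewrite sub_capmx => /andP[/submxP[w vw] /sub_kermxP vc].
have vD : v *m D = v by rewrite vw -mulmxA DD.
have -> : v = (v *m psi) *m (Df *m phi) - (v *m s) *m (D' *m d).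
  rewrite Dp Dd !mulmxA -(mulmxA v psi) pp2 -mulmxBl !mulmxDr mulmx1.
  by rewrite !mulmxA vc mul0mx addr0 addrK vD.
by rewrite addmx_sub_adds ?eqmx_opp ?submxMl.
Qed.

End RankIdentity.

(** The components of chain maps and homotopies have types that depend on the index,
    and P is the solvability condition that makes the next component exist. *)
Lemma dependent_sequence (X : nat -> Type) (P : forall i, X i -> Prop)
    (Q : forall i, X i -> X i.+1 -> Prop) (x0 : X 0) : P 0 x0 ->
  (forall i x, P i x -> exists2 y, P i.+1 y & Q i x y) ->
  exists2 f : forall i, X i, f 0 = x0 & forall i, P i (f i) /\ Q i (f i) (f i.+1).
Proof.
move=> P0 step.
have step' i (x : {x | P i x}) : {y : {y | P i.+1 y} | Q i (sval x) (sval y)}.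
  apply: constructive_indefinite_description.
  by case: x => x Px; case: (step i x Px) => y Py Qxy; exists (exist _ y Py).
pose f := fix f i : {x | P i x} :=
  if i is i'.+1 then sval (step' i' (f i')) else exist _ x0 P0.
exists (fun i => sval (f i)) => // i; split; first exact: (svalP (f i)).
exact: (svalP (step' i (f i))).
Qed.

Section Graded.
Variables (K : fieldType) (n : nat).
Local Notation R := {mpoly K[n]}.

Lemma pihomogM (p q : R) d e : q \is e.-homog ->
  pihomog mdeg d (p * q) = if (e <= d)%N then pihomog mdeg (d - e) p * q else 0.
Proof.
move=> qe; pose k := (maxn (msize p) d).+1.
have pk : (msize p <= k)%N by rewrite /k ltnW // ltnS leq_maxl.
rewrite {1}(pihomog_partitionE pk) mulr_suml linear_sum /=.
have term i : pihomog mdeg d (pihomog mdeg i p * q) =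
    if (i + e == d)%N then pihomog mdeg i p * q else 0.
  have he : pihomog mdeg i p * q \is (i + e).-homog by apply: dhomogM qe; apply: pihomogP.
  by case: eqVneq => [<-|ne]; [rewrite pihomog_dE | rewrite (pihomog_ne0 ne)].
under eq_bigr => i _ do rewrite term.
case: leqP => [ed|de]; last first.
  by apply: big1 => i _; rewrite gtn_eqF // (leq_trans de) // leq_addl.
have lt : (d - e < k)%N by rewrite /k ltnS (leq_trans (leq_subr _ _)) // leq_maxr.
rewrite (bigD1 (Ordinal lt)) //= subnK // eqxx big1 ?addr0 // => i ne.
case: eqP => // E; case/eqP: ne; apply: val_inj => /=; by rewrite -E addnK.
Qed.

(** The homogeneous component of degree s of a row, its coordinate b being in
    degree t b. *)
Definition homog_row q (s : nat) (t : 'I_q -> nat) (w : 'rV[R]_q) : 'rV[R]_q :=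
  \row_b (if (t b <= s)%N then pihomog mdeg (s - t b) (w 0 b) else 0).

Lemma mul_homog_row q r s (t : 'I_q -> nat) (u : 'I_r -> nat) (w : 'rV[R]_q) M c :
  graded_mx t u M ->
  (homog_row s t w *m M) 0 c =
    if (u c <= s)%N then pihomog mdeg (s - u c) ((w *m M) 0 c) else 0.
Proof.
move=> gM; rewrite !mxE; case: leqP => [us|us]; last first.
  apply: big1 => b _; rewrite mxE; have [->|/gM[ut _]] := eqVneq (M b c) 0.
    by rewrite mulr0.
  by rewrite leqNgt (leq_trans us ut) mul0r.
rewrite linear_sum /=; apply: eq_bigr => b _; rewrite mxE.
have [->|/gM[ut hM]] := eqVneq (M b c) 0; first by rewrite !mulr0 linear0.
rewrite (pihomogM _ _ hM) leq_subLR subnKC //.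
by case: leqP => ts; rewrite ?mul0r // subnBA // subnK.
Qed.

Lemma rows_solve p q r (X : 'M[R]_(p, r)) (M : 'M_(q, r)) :
  (forall a, exists w, row a X = w *m M) -> exists Y, X = Y *m M.
Proof.
move=> /fin_all_exists[w Hw]; exists (\matrix_a w a).
by apply/row_matrixP => a; rewrite Hw row_mul rowK.
Qed.

(** Solvable row by row implies solvable by a graded matrix: homogeneous components
    of arbitrary solutions are solutions, because M is graded. *)
Lemma graded_solve p q r (s : 'I_p -> nat) (t : 'I_q -> nat) (u : 'I_r -> nat)
    (X : 'M[R]_(p, r)) (M : 'M_(q, r)) :
  graded_mx s u X -> graded_mx t u M ->
  (forall a, exists w, row a X = w *m M) ->
  exists2 Y, graded_mx s t Y & X = Y *m M.
Proof.
move=> gX gM /fin_all_exists[w Hw]; exists (\matrix_a homog_row (s a) t (w a)).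
  move=> a b; rewrite !mxE; case: leqP => [ts _|]; last by rewrite eqxx.
  by split=> //; apply: pihomogP.
apply/row_matrixP => a; rewrite row_mul rowK; apply/rowP => c.
rewrite (mul_homog_row _ _ _ gM) -Hw !mxE.
have [->|/gX[us hX]] := eqVneq (X a c) 0; first by rewrite linear0 if_same.
by rewrite us pihomog_dE.
Qed.

Lemma graded_mulmx p q r (s : 'I_p -> nat) (t : 'I_q -> nat) (u : 'I_r -> nat)
    (X : 'M[R]_(p, q)) (Y : 'M_(q, r)) :
  graded_mx s t X -> graded_mx t u Y -> graded_mx s u (X *m Y).
Proof.
move=> gX gY a c; rewrite mxE => nz.
have [us|us] := leqP (u c) (s a); last first.
  case/eqP: nz; apply: big1 => b _.
  have [->|/gX[ts _]] := eqVneq (X a b) 0; first by rewrite mul0r.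
  have [->|/gY[ut _]] := eqVneq (Y b c) 0; first by rewrite mulr0.
  by have := leq_trans (leq_trans us ut) ts; rewrite ltnn.
split=> //; apply: rpred_sum => b _.
have [->|/gX[ts hX]] := eqVneq (X a b) 0; first by rewrite mul0r rpred0.
have [->|/gY[ut hY]] := eqVneq (Y b c) 0; first by rewrite mulr0 rpred0.
have := dhomogM hX hY; congr (_ \is _.-homog).
by rewrite addnBA // subnK.
Qed.

Definition const_part p q (M : 'M[R]_(p, q)) : 'M[K]_(p, q) :=
  map_mx (mcoeff 0%MM) M.

Lemma const_partM p q r (X : 'M[R]_(p, q)) (Y : 'M_(q, r)) : const_part (X *m Y) = const_part X *m const_part Y.
Proof. exact: map_mxM. Qed.

Lemma const_part1 p : const_part (1%:M : 'M[R]_p) = 1%:M.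
Proof. exact: map_mx1. Qed.

Lemma const_partD p q (X Y : 'M[R]_(p, q)) : const_part (X + Y) = const_part X + const_part Y.
Proof. exact: map_mxD. Qed.

Definition deg_proj p (s : 'I_p -> nat) (j : nat) : 'M[K]_p :=
  \matrix_(a, b) ((a == b) && (s a == j))%:R.

(** A homogeneous polynomial of positive degree has no constant term, so the
    constant part of a graded matrix preserves degrees strictly. *)
Lemma graded_const_part p q (s : 'I_p -> nat) (t : 'I_q -> nat) (X : 'M[R]_(p, q)) a b :
  graded_mx s t X -> const_part X a b != 0 -> s a = t b.
Proof.
move=> gX; rewrite mxE => nz.
have /gX[ts hX] : X a b != 0 by apply: contraNneq nz => ->; rewrite mcoeff0.
have /eqP : mdeg (0%MM : 'X_{1..n}) == (s a - t b)%N.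
  by apply/eqP; apply: (dhomog_mf hX); rewrite mcoeff_msupp.
rewrite mdeg0 => /esym/eqP; rewrite subn_eq0 => st.
by apply/eqP; rewrite eqn_leq st.
Qed.

Lemma mul_deg_proj_l p q (s : 'I_p -> nat) j (X : 'M[K]_(p, q)) a b :
  (deg_proj s j *m X) a b = if s a == j then X a b else 0.
Proof.
rewrite mxE (bigD1 a) //= big1 => [|k ka]; last by rewrite mxE eq_sym (negPf ka) mul0r.
by rewrite mxE eqxx addr0; case: ifP; rewrite ?mul1r ?mul0r.
Qed.

Lemma mul_deg_proj_r p q (t : 'I_q -> nat) j (X : 'M[K]_(p, q)) a b :
  (X *m deg_proj t j) a b = if t b == j then X a b else 0.
Proof.
rewrite mxE (bigD1 b) //= big1 => [|k kb]; last by rewrite mxE (negPf kb) mulr0.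
by rewrite mxE eqxx addr0; case: ifP; rewrite ?mulr1 ?mulr0.
Qed.

Lemma deg_proj_comm p q (s : 'I_p -> nat) (t : 'I_q -> nat) (X : 'M[R]_(p, q)) j :
  graded_mx s t X -> deg_proj s j *m const_part X = const_part X *m deg_proj t j.
Proof.
move=> gX; apply/matrixP => a b; rewrite mul_deg_proj_l mul_deg_proj_r.
by have [->|/(graded_const_part gX)->] := eqVneq (const_part X a b) 0; rewrite ?if_same.
Qed.

Lemma deg_proj_idem p (s : 'I_p -> nat) j : deg_proj s j *m deg_proj s j = deg_proj s j.
Proof.
apply/matrixP => a b; rewrite mul_deg_proj_l !mxE.
by case: (s a == j); rewrite ?andbF.
Qed.

Lemma rank_deg_proj p (s : 'I_p -> nat) j :
  \rank (deg_proj s j) = #|[set a | s a == j]|.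
Proof. exact: (rank_indicator K (fun a => s a == j)). Qed.

Lemma mulmx_eq0 p q r (X : 'M[R]_(p, q)) (Y : 'M_(q, r)) :
  (forall v : 'rV_p, v *m X *m Y = 0) -> X *m Y = 0.
Proof.
move=> XY0; apply/row_matrixP => a; rewrite row0 rowE.
by rewrite mulmxA XY0.
Qed.

End Graded.

(** What the comparison of resolutions uses about I. *)
Record homog_ideal (K : fieldType) n (I : {mpoly K[n]} -> Prop) : Prop := HomogIdeal {
  hid_add : forall p q, I p -> I q -> I (p + q);
  hid_mul : forall p q, I q -> I (p * q);
  hid_homog : forall d p, I p -> I (pihomog mdeg d p)
}.

Section Comparison.
Variables (K : fieldType) (n : nat) (I : {mpoly K[n]} -> Prop).
Local Notation R := {mpoly K[n]}.
Hypothesis idI : homog_ideal I.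
Implicit Types (A B F G : free_seq K n).

Lemma min_resolution_free F : min_free_resolution I F -> free_resolution I F.
Proof. by case=> *; split. Qed.

Lemma resolution_dd F i : free_resolution I F -> gdiff F i.+1 *m gdiff F i = 0.
Proof.
move=> rF; apply: mulmx_eq0 => v.
by apply/(fr_exactS rF); exists v.
Qed.

Lemma ideal_sum (J : finType) (f : J -> R) :
  I 0 -> (forall i, I (f i)) -> I (\sum_i f i).
Proof. by move=> I0 If; elim/big_ind: _ => //; apply: hid_add idI. Qed.

Lemma ideal0 p : I p -> I 0.
Proof. by move=> /(hid_mul idI 0); rewrite mul0r. Qed.

Lemma ideal_row_mul m (v : 'rV[R]_m) (u : 'cV[R]_m) : I 0 ->
  (forall a, I (u a 0)) -> I ((v *m u) 0 0).
Proof. by move=> I0 Iu; rewrite mxE; apply: ideal_sum => // a; apply: hid_mul. Qed.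

Lemma resolution_ideal0 F : free_resolution I F -> I 0.
Proof. by move=> rF; have [v Iv] := fr_aug_surj rF 0; apply: ideal0 Iv. Qed.

Lemma resolution_aug_diff F : free_resolution I F ->
  forall a, I ((gdiff F 0 *m gaug F) a 0).
Proof.
move=> rF a; rewrite [X in I X](_ : _ = (row a (gdiff F 0) *m gaug F) 0 0).
  by apply/(fr_exact0 rF); exists (delta_mx 0 a); rewrite rowE.
by rewrite -row_mul [RHS]mxE.
Qed.

(** Freeness of the source and exactness of the target: each component is obtained
    by lifting the previous one, and homogeneous components make it graded. *)
Lemma chain_map A B : free_resolution I A -> free_resolution I B ->
  exists2 phi : forall i, 'M[R]_(grank A i, grank B i),
    (forall i, graded_mx (@gdeg K n A i) (@gdeg K n B i) (phi i)) &
    (forall a, I ((gaug A - phi 0%N *m gaug B) a 0)) /\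
    (forall i, gdiff A i *m phi i = phi i.+1 *m gdiff B i).
Proof.
move=> rA rB; have I0 := resolution_ideal0 rA.
have [phi0 g0 I_phi0] : exists2 phi0 : 'M[R]_(grank A 0, grank B 0),
    graded_mx (@gdeg K n A 0) (@gdeg K n B 0) phi0 &
    forall a, I ((gaug A - phi0 *m gaug B) a 0).
  have /fin_all_exists[w Hw] : forall a, exists w : 'rV[R]_(grank B 0),
      I (gaug A a 0 - (w *m gaug B) 0 0).
    by move=> a; apply: fr_aug_surj.
  exists (\matrix_a homog_row (gdeg a) (@gdeg K n B 0) (w a)).
    move=> a b; rewrite !mxE; case: leqP => [ts _|]; last by rewrite eqxx.
    by split=> //; apply: pihomogP.
  move=> a; have := hid_homog idI (gdeg a) (Hw a); rewrite linearB /=.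
  have aug_a : pihomog mdeg (gdeg a) (gaug A a 0) = gaug A a 0.
    have [->|/(fr_aug_graded rA)[_]] := eqVneq (gaug A a 0) 0; first by rewrite linear0.
    by rewrite subn0 => /pihomog_dE.
  have := mul_homog_row (gdeg a) (w a) 0 (fr_aug_graded rB).
  rewrite leq0n subn0 aug_a => <-; congr I.
  rewrite [RHS]mxE; congr (_ + _); rewrite [RHS]mxE; congr (- _).
  rewrite -(rowK (fun a => homog_row (gdeg a) (@gdeg K n B 0) (w a)) a).
  by rewrite -row_mul mxE.
pose P i (phi : 'M[R]_(grank A i, grank B i)) :=
  graded_mx (@gdeg K n A i) (@gdeg K n B i) phi /\
  forall a, exists w, row a (gdiff A i *m phi) = w *m gdiff B i.
pose Q i (phi : 'M[R]_(grank A i, grank B i)) (psi : 'M[R]_(grank A i.+1, grank B i.+1)) :=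
  gdiff A i *m phi = psi *m gdiff B i.
have [||phi phi0E H] := @dependent_sequence _ P Q phi0.
- split=> // a; apply/(fr_exact0 rB).
  have := hid_add idI (hid_mul idI (-1) (ideal_row_mul (row a (gdiff A 0)) I0 I_phi0))
    (resolution_aug_diff rA a).
  congr I; rewrite mulN1r mulmxBr row_mul -mulmxA.
  have <- : (row a (gdiff A 0) *m gaug A) 0 0 = (gdiff A 0 *m gaug A) a 0.
    by rewrite -row_mul mxE.
  set x := row _ _ *m gaug A; set y := row _ _ *m _.
  by rewrite [(x - y) 0 0]mxE [(- y) 0 0]mxE opprB subrK.
- move=> i phi [gphi sol].
  have gA : graded_mx (@gdeg K n A i.+1) (@gdeg K n A i) (gdiff A i) by apply: fr_diff_graded rA _.
  have gB : graded_mx (@gdeg K n B i.+1) (@gdeg K n B i) (gdiff B i) by apply: fr_diff_graded rB _.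
  have [psi gpsi E] := graded_solve (graded_mulmx gA gphi) gB sol.
  exists psi => //; split=> // a; apply/(fr_exactS rB).
  by rewrite -row_mul -mulmxA -E mulmxA resolution_dd // mul0mx row0.
exists phi => [i|]; first by case: (H i) => -[].
by split=> [a|i]; [rewrite phi0E; apply: I_phi0 | case: (H i)].
Qed.

(** The same lifting principle, for an endomorphism that induces zero on R/I. *)
Lemma null_homotopy A (theta : forall i, 'M[R]_(grank A i)) : free_resolution I A ->
  (forall a, I ((theta 0%N *m gaug A) a 0)) ->
  (forall i, gdiff A i *m theta i = theta i.+1 *m gdiff A i) ->
  exists s : forall i, 'M[R]_(grank A i, grank A i.+1),
    theta 0%N = s 0%N *m gdiff A 0 /\
    forall i, theta i.+1 = gdiff A i *m s i + s i.+1 *m gdiff A i.+1.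
Proof.
move=> rA I0 th.
have [s0 s0E] : exists s0, theta 0%N = s0 *m gdiff A 0.
  apply: rows_solve => a; apply/(fr_exact0 rA).
  by rewrite -row_mul mxE.
pose P i (s : 'M[R]_(grank A i, grank A i.+1)) :=
  (theta i.+1 - gdiff A i *m s) *m gdiff A i = 0.
pose Q i (s : 'M[R]_(grank A i, grank A i.+1)) (s' : 'M[R]_(grank A i.+1, grank A i.+2)) :=
  theta i.+1 = gdiff A i *m s + s' *m gdiff A i.+1.
have [||s s0s H] := @dependent_sequence _ P Q s0.
- by rewrite /P mulmxBl -mulmxA -s0E th subrr.
- move=> i s Ps; have [s' E] : exists s', theta i.+1 - gdiff A i *m s = s' *m gdiff A i.+1.
    by apply: rows_solve => a; apply/(fr_exactS rA); rewrite -row_mul Ps row0.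
  exists s'; last by rewrite /Q -E addrC subrK.
  rewrite /P mulmxBl -th -mulmxA -E mulmxBr mulmxA resolution_dd // mul0mx subr0.
  by rewrite subrr.
by exists s; split=> [|i]; [rewrite s0s | case: (H i)].
Qed.

End Comparison.

(** * Betti numbers from ranks of constant parts *)

Section BettiRank.
Variables (K : fieldType) (n : nat) (I : {mpoly K[n]} -> Prop).
Local Notation R := {mpoly K[n]}.
Hypothesis idI : homog_ideal I.
Implicit Types (A B F G : free_seq K n).

(** The composite minus the identity induces zero on R/I. *)
Lemma composite_homotopic A B
    (phi : forall i, 'M[R]_(grank A i, grank B i))
    (psi : forall i, 'M[R]_(grank B i, grank A i)) :
  free_resolution I A ->
  (forall a, I ((gaug A - phi 0%N *m gaug B) a 0)) ->
  (forall i, gdiff A i *m phi i = phi i.+1 *m gdiff B i) ->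
  (forall a, I ((gaug B - psi 0%N *m gaug A) a 0)) ->
  (forall i, gdiff B i *m psi i = psi i.+1 *m gdiff A i) ->
  exists s : forall i, 'M[R]_(grank A i, grank A i.+1),
    phi 0%N *m psi 0%N = 1%:M + s 0%N *m gdiff A 0 /\
    forall i, phi i.+1 *m psi i.+1 =
      1%:M + gdiff A i *m s i + s i.+1 *m gdiff A i.+1.
Proof.
move=> rA Iphi phiC Ipsi psiC.
have I0 := resolution_ideal0 idI rA.
have [a|i|s [s0 sS]] := @null_homotopy K n I A (fun i => phi i *m psi i - 1%:M) rA.
- have := hid_mul idI (-1) (hid_add idI (Iphi a)
    (ideal_row_mul idI (row a (phi 0%N)) I0 Ipsi)).
  congr I; rewrite mulN1r mulmxBl mul1mx mulmxBr -row_mul -mulmxA -row_mul.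
  set x := _ *m (_ *m _); set y := _ *m gaug B; set z := gaug A.
  rewrite [LHS](_ : _ = - ((z a 0 - y a 0) + (y a 0 - x a 0))); last by rewrite !mxE.
  by rewrite subrKA opprB !mxE.
- by rewrite mulmxBr mulmxBl mulmx1 mul1mx mulmxA phiC -mulmxA psiC mulmxA.
exists s; split=> [|i]; first by rewrite -s0 addrC subrK.
by rewrite -addrA -sS addrC subrK.
Qed.

(** After reduction modulo the variables the differential of F vanishes, so F is
    isomorphic to the homology of the constant part of G; counting dimensions in
    degree j gives the rank formula. *)
Lemma betti_rank F G i j : min_free_resolution I F -> free_resolution I G ->
  (#|[set a : 'I_(grank F i) | gdeg a == j]|
   + \rank (deg_proj K (@gdeg K n G i.+1) j *m const_part (gdiff G i))
   + (if i is i'.+1 then \rank (deg_proj K (@gdeg K n G i'.+1) j *m const_part (gdiff G i')) else 0)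
   = #|[set a : 'I_(grank G i) | gdeg a == j]|)%N.
Proof.
move=> mF rG; have rF := min_resolution_free mF.
have [phi gphi [Iphi phiC]] := chain_map idI rF rG.
have [psi _ [Ipsi psiC]] := chain_map idI rG rF.
have [s [s0 sS]] := composite_homotopic rF Iphi phiC Ipsi psiC.
have [t [t0 tS]] := composite_homotopic rG Ipsi psiC Iphi phiC.
have dF0 k : const_part (gdiff F k) = 0.
  by apply/matrixP => a b; rewrite !mxE (mfr_minimal mF).
have pp k : const_part (phi k) *m const_part (psi k) = 1%:M.
  by case: k => [|k]; rewrite -const_partM ?s0 ?sS !const_partD !const_partM ?dF0 ?mul0mx !mulmx0 ?addr0 const_part1.
have phid k : const_part (phi k.+1) *m const_part (gdiff G k) = 0.
  by rewrite -const_partM -phiC const_partM dF0 mul0mx.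
have dpsi k : const_part (gdiff G k) *m const_part (psi k) = 0.
  by rewrite -const_partM psiC const_partM dF0 mulmx0.
have dd k : const_part (gdiff G k.+1) *m const_part (gdiff G k) = 0.
  by rewrite -const_partM (resolution_dd _ rG) /const_part map_mx0.
have gdG k : graded_mx (@gdeg K n G k.+1) (@gdeg K n G k) (gdiff G k).
  exact: (fr_diff_graded rG).
rewrite -(rank_deg_proj K (@gdeg K n F i)) -(rank_deg_proj K (@gdeg K n G i)).
case: i => [|i].
  have := @homology_rank K _ _ _ 0 (const_part (phi 0%N)) (const_part (psi 0%N)) (const_part (gdiff G 0)) 0
    (const_part (t 0%N)) 0 (deg_proj K (@gdeg K n F 0) j) (deg_proj K (@gdeg K n G 0) j)
    (deg_proj K (@gdeg K n G 1) j).
  rewrite !mulmx0 mxrank0; apply=> //.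
  - by rewrite -const_partM t0 const_partD const_part1 const_partM addr0.
  - exact: deg_proj_comm.
  - exact: deg_proj_comm.
  - exact: deg_proj_idem.
apply: (@homology_rank K _ _ _ _ (const_part (phi i.+1)) (const_part (psi i.+1)) (const_part (gdiff G i.+1))
   _ (const_part (t i.+1)) (const_part (t i))) => //.
- by rewrite -const_partM tS !const_partD const_part1 !const_partM addrAC.
- exact: deg_proj_comm.
- exact: deg_proj_comm.
- exact: deg_proj_idem.
Qed.

End BettiRank.

(** * Slices of the constant part *)

Section Slices.
Variables (K : fieldType) (T : finType).
Local Notation n := #|T|.
Local Notation R := {mpoly K[n]}.
Implicit Types (Sigma : {set {set T}}) (F G : {set T}).

(** The constant terms of the weights of the resolution. *)
Definition flip_weight g F : K := if g \in F then -1 else 0.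

(** The constant part keeps F :|: G fixed, hence its total size j, and raises #|F|.
    In total size j it is a complex whose s-th term is spanned by the s-th slice:
    the sum over #|W| = j of the reduced cochain complexes of the induced
    subcomplexes on W, shifted. *)
Definition slice Sigma (j s : nat) : {set {set T} * {set T}} :=
  [set p | [&& face_pair Sigma p.1 p.2, #|p.1| == s & pair_deg p == j]].

Definition slice_rank Sigma (j s : nat) : nat :=
  \rank (smx (slice Sigma j s) (slice Sigma j s.+1) (diff_coef flip_weight)).

Lemma sr_homog_ideal Sigma : homog_ideal (@sr_ideal K T Sigma).
Proof.
split=> [p q [c ->] [c' ->]|p q [c ->]|d p [c ->]].
- by exists (fun A => c A + c' A); rewrite -big_split; apply: eq_bigr => A _; rewrite mulrDl.
- by exists (fun A => p * c A); rewrite mulr_sumr; apply: eq_bigr => A _; rewrite mulrA.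
- exists (fun A : {set T} => if (#|A| <= d)%N then pihomog mdeg (d - #|A|) (c A) else 0).
  rewrite linear_sum /=; apply: eq_bigr => A _; rewrite (@pihomogM K _ (c A) _ d #|A|).
    by case: ifP; rewrite ?mul0r.
  by rewrite set_monoE dhomogX /= mdeg_setm.
Qed.

Lemma const_diff_coef p q :
  (diff_coef (@poly_weight K T) p q)@_0%MM = diff_coef flip_weight p q.
Proof.
rewrite raddf_sum; apply: eq_bigr => g _ /=; case: ifP => _; last by rewrite mcoeff0.
rewrite ksgn_mpolyC mcoeffCM /flip_weight /poly_weight; congr (_ * _).
case: ifP => _; first by rewrite mcoeffN mcoeff1 eqxx.
by rewrite mcoeffX -mdeg_eq0 mdeg1.
Qed.

Lemma flip_coef_neq0 p q : diff_coef flip_weight p q != 0 ->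
  #|q.1| = #|p.1|.+1 /\ pair_deg q = pair_deg p.
Proof.
move=> nz; case/diff_coef_neq0: (nz) => g gG pE; case: q gG pE nz => F G /= gG ->.
rewrite diff_coef_move // /flip_weight; case: (boolP (g \in F)) => gF; last first.
  by rewrite mulr0 eqxx.
move=> _; rewrite /pair_deg /= cardsU1 gG [#|F| in LHS](cardsD1 g) gF.
by rewrite [in #|F|](cardsD1 g) gF addnCA.
Qed.

Lemma slice_rank_out Sigma j s : slice Sigma j s.+1 = set0 -> slice_rank Sigma j s = 0%N.
Proof.
move=> E; apply/eqP; rewrite -leqn0 -(cards0 ({set T} * {set T})%type) -E.
exact: rank_leq_col.
Qed.

(** Homological degree i.+1 and internal degree i.+1 + s mean #|G| = i.+1 and
    #|F| = s, so the differential goes from slice s to slice s.+1. *)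
Lemma rank_level Sigma i s :
  \rank (deg_proj K (@gdeg K n (sr_resolution K Sigma) i.+1) (i.+1 + s)
          *m const_part (gdiff (sr_resolution K Sigma) i))
  = slice_rank Sigma (i.+1 + s) s.
Proof.
rewrite /slice_rank; set j := (i.+1 + s)%N.
pose c p q := if pair_deg p == j then diff_coef flip_weight p q else 0.
have -> : deg_proj K (@gdeg K n (sr_resolution K Sigma) i.+1) j
          *m const_part (gdiff (sr_resolution K Sigma) i)
    = smx (pair_basis Sigma i.+1) (pair_basis Sigma i) c.
  apply/matrixP => a b; rewrite mul_deg_proj_l !mxE const_diff_coef /c.
  by [].
rewrite (@rank_smx_supp K _ _ _ (slice Sigma j s) (slice Sigma j s.+1)).
- congr (\rank _); apply: eq_smx => p q; rewrite inE => /and3P[_ _ pj] _.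
  by rewrite /c pj.
- apply/subsetP => p; rewrite !inE => /and3P[-> /eqP ps /=].
  by rewrite /pair_deg ps addnC eqn_add2r.
- apply/subsetP => p; rewrite !inE => /and3P[-> /eqP ps /=].
  by rewrite /pair_deg ps /j addSnnS addnC eqn_add2r.
move=> p q pB qB out; rewrite /c; case: eqP => // pj; apply/eqP.
apply: contraNT out => /flip_coef_neq0[qp1 qp]; move: pB qB.
rewrite !inE => /andP[-> /eqP p2] /andP[-> _]; rewrite qp pj eqxx qp1 eqSS.
by rewrite !andbT /= andbb -(eqn_add2r #|p.2|) -/(pair_deg p) pj p2 addnC.
Qed.

Lemma rank_level_low Sigma i j : (j <= i)%N ->
  \rank (deg_proj K (@gdeg K n (sr_resolution K Sigma) i.+1) j
          *m const_part (gdiff (sr_resolution K Sigma) i)) = 0%N.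
Proof.
move=> ji; apply/eqP; rewrite mxrank_eq0; apply/eqP/matrixP => a b.
rewrite mul_deg_proj_l [RHS]mxE; case: eqP => // aj.
have := enum_valP a; rewrite inE => /andP[_ /eqP a2].
by move: aj ji; rewrite /= /pair_deg a2 => <-; rewrite addnS ltnNge leq_addl.
Qed.

(** The Betti number in homological degree i and internal degree i + s is the
    dimension of the homology of the slices at s: a form of Hochster's formula. *)
Lemma sr_betti_slices Sigma beta :
  complex_closed Sigma -> set0 \in Sigma -> sr_betti K Sigma beta ->
  (forall i s, beta i (i + s) + slice_rank Sigma (i + s) s +
      (if s is s'.+1 then slice_rank Sigma (i + s) s' else 0)
      = #|slice Sigma (i + s) s|)%N /\
  (forall i j, (j < i)%N -> beta i j = 0%N).
Proof.
move=> SC S0 [F mF bF].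
have rG := sr_resolution_free K SC S0.
have H i j := betti_rank (sr_homog_ideal Sigma) i j mF rG.
have card_level i j : #|[set a : 'I_(grank (sr_resolution K Sigma) i) | gdeg a == j]|
    = #|[set p in pair_basis Sigma i | pair_deg p == j]|.
  exact: (card_enum_val (pair_basis Sigma i) (fun p => pair_deg p == j)).
split=> [i s|i j ji]; last first.
  apply/eqP; rewrite bF -leqn0; apply: leq_trans (_ : #|[set p in pair_basis Sigma i | pair_deg p == j]| <= _)%N.
    by rewrite -card_level -(H i j) -addnA leq_addr.
  rewrite leqn0 cards_eq0; apply/eqP/setP => p; rewrite !inE /pair_deg.
  apply/negbTE/negP => /andP[/andP[_ /eqP p2] /eqP pj].
  by move: ji; rewrite -pj p2 ltnNge leq_addl.
have := H i (i + s)%N; rewrite card_level -bF.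
have -> : [set p in pair_basis Sigma i | pair_deg p == (i + s)%N] = slice Sigma (i + s) s.
  apply/setP => p; rewrite !inE -andbA; congr (_ && _); rewrite /pair_deg.
  apply/andP/andP => -[/eqP E1 /eqP E2]; split; apply/eqP => //.
    by move: E2; rewrite E1 addnC => /addnI.
  by move: E2; rewrite E1 addnC => /addIn.
move=> <-; rewrite -addnA [RHS]addnAC -addnA; congr (_ + (_ + _))%N.
  case: i => [|i]; last by rewrite rank_level.
  apply: slice_rank_out; apply/setP => p; rewrite !inE /pair_deg; apply/negP => /and3P[_ /eqP -> /eqP].
  by move/eqP; rewrite add0n addSn gtn_eqF // ltnS leq_addr.
case: s => [|s]; first by rewrite rank_level_low // addn0.
by rewrite addnS -addSn rank_level.
Qed.

End Slices.

(** * Acyclicity coming from a leaf order *)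

Section ForestFaces.
Variables (T : finType) (S : seq {set T}).
Local Notation nthS := (nth set0 S).
Implicit Types (F G : {set T}).

Definition first_faces (m : nat) : {set {set T}} :=
  [set F : {set T} | [exists i : 'I_m, F \subset nthS i]].

Definition leafy : Prop :=
  forall m : nat, (0 < m < size S)%N ->
    exists2 p : nat, (p < m)%N &
      forall i : nat, (i < m)%N -> nthS m :&: nthS i \subset nthS m :&: nthS p.

(** The part of the m-th facet that lies in the union of the earlier ones; for
    m = i.+1 it is the separator of index i. *)
Definition attach (m : nat) : {set T} := (\bigcup_(i < m) nthS i) :&: nthS m.

Lemma first_facesP m F :
  reflect (exists2 i, (i < m)%N & F \subset nthS i) (F \in first_faces m).
Proof.
rewrite inE; apply: (iffP existsP) => [[i Fi]|[i im Fi]]; first by exists i.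
by exists (Ordinal im).
Qed.

Lemma first_faces_closed m : complex_closed (first_faces m).
Proof.
move=> F F' FF' /first_facesP[i im Fi]; apply/first_facesP.
by exists i => //; apply: subset_trans Fi.
Qed.

Lemma first_faces0 : first_faces 0 = set0.
Proof. by apply/setP => F; rewrite [RHS]inE; apply/first_facesP => -[]. Qed.

Lemma first_facesS m F :
  (F \in first_faces m.+1) = (F \in first_faces m) || (F \subset nthS m).
Proof.
apply/first_facesP/orP => [[i]|[/first_facesP[i im Fi]|Fm]].
- rewrite ltnS leq_eqVlt => /orP[/eqP->|im Fi]; [by right | left].
  by apply/first_facesP; exists i.
- by exists i => //; apply: ltnW.
- by exists m.
Qed.

(** The branch of the m-th facet contains the whole of attach m, so attach m, and
    not merely each of its vertices, is a face of the earlier part. *)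
Lemma first_faces_attach m F : leafy -> (0 < m < size S)%N ->
  (F \in first_faces m) && (F \subset nthS m) = (F \subset attach m).
Proof.
move=> lf mS; have [p pm Hp] := lf m mS.
apply/andP/idP => [[/first_facesP[i im Fi] Fm]|].
  by rewrite subsetI Fm andbT (subset_trans Fi) // (bigcup_sup (Ordinal im)).
rewrite subsetI => /andP[/subsetP FU Fm]; split=> //; apply/first_facesP; exists p => //.
apply/subsetP => x xF; have /bigcupP[i _ xi] := FU x xF.
have /subsetP/(_ x) := Hp i (ltn_ord i); rewrite !inE xi (subsetP Fm _ xF) /=; by apply.
Qed.

(** The empty set is excluded because for m = 0 there is no earlier part at all. *)
Lemma first_faces_attach_neq0 m F : leafy -> (m < size S)%N -> F != set0 ->
  F \subset nthS m -> (F \in first_faces m) = (F \subset attach m).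
Proof.
case: m => [|m] lf mS F0 Fm.
  by rewrite first_faces0 inE /attach big_ord0 set0I subset0 (negPf F0).
by rewrite -first_faces_attach ?Fm ?andbT.
Qed.

End ForestFaces.

Section ForestAcyclic.
Variables (K : fieldType) (T : finType) (S : seq {set T}).
Local Notation nthS := (nth set0 S).
Local Notation Delta := (first_faces S (size S)).
Implicit Types (F G : {set T}) (u w : {set T} -> {set T} -> K).
Local Notation flip := (@flip_weight K T).

Lemma kdiff_flip u F G : [disjoint F & G] ->
  kdiff flip u F G = - \sum_(g in F) ksgn K g G * u (F :\ g) (g |: G).
Proof.
move=> dFG; rewrite /kdiff big_mkcond -sumrN [RHS]big_mkcond.
apply: eq_bigr => g _; rewrite /flip_weight.
case: (boolP (g \in F)) => gF; last by rewrite mulr0 mul0r if_same.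
by rewrite (disjointFr dFG gF) /= mulrN1 mulNr.
Qed.

Lemma flip_weightD g h F : g != h -> flip g (F :\ h) = flip g F.
Proof. by move=> gh; rewrite /flip_weight !inE gh. Qed.

(** Induction on the number m of facets. Let Q be the set along which the facet
    S_m is attached. For a fixed W = F :|: G, the faces of S_m not contained in Q,
    the new ones, are matched by moving a vertex x of W in and out of F; x is taken
    in Q when W meets Q, and in S_m otherwise. Removing x from a new face of size
    at least 2 leaves a new face: if x is in Q this is clear, and if W misses Q
    then every nonempty face inside W is new. In size 1 the argument breaks down,
    which reflects that induced subcomplexes may be disconnected. *)
Lemma forest_acyclic u : leafy S ->
  (forall F G, face_pair Delta F G -> kdiff flip u F G = 0) ->
  exists w, forall F G, face_pair Delta F G -> (2 <= #|F|)%N -> u F G = kdiff flip w F G.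
Proof.
move=> lf u_cycle.
suff : forall m, (m <= size S)%N -> exists w, forall F G,
    F \in first_faces S m -> [disjoint F & G] -> (2 <= #|F|)%N -> u F G = kdiff flip w F G.
  by case/(_ _ (leqnn _)) => w Hw; exists w => F G /andP[]; apply: Hw.
elim=> [|m IH] mS; first by exists (fun _ _ => 0) => F G; rewrite first_faces0 inE.
have [w Hw] := IH (ltnW mS).
pose u' F G := u F G - kdiff flip w F G.
have u'_cycle F G : face_pair Delta F G -> kdiff flip u' F G = 0.
  by move=> FG; rewrite kdiffB u_cycle // kdiff_sqr ?subr0 //; apply: flip_weightD.
have u'_low F G : F \in first_faces S m -> [disjoint F & G] -> (2 <= #|F|)%N ->
    u' F G = 0.
  by move=> Fm dFG F2; rewrite /u' -Hw ?subrr.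
pose Q := attach S m.
pose apex (W : {set T}) :=
  if [pick x in W :&: Q] is Some x then Some x else [pick x in W :&: nthS m].
(* Contraction on the new faces of S_m: put x into F when it is in G. *)
pose w' F G := if apex (F :|: G) is Some x then
    if [&& F \notin first_faces S m, F \subset nthS m & x \in G]
    then - (ksgn K x (G :\ x) * u' (x |: F) (G :\ x)) else 0
  else 0.
suff Hw' F G : F \in first_faces S m.+1 -> [disjoint F & G] -> (2 <= #|F|)%N ->
    kdiff flip w' F G = u' F G.
  exists (fun F G => w F G - - w' F G) => F G Fm dFG F2.
  rewrite kdiffB -[LHS](subrK (kdiff flip w F G)) -/(u' F G) -Hw' // addrC.
  congr (_ + _); rewrite /kdiff -sumrN; apply: eq_bigr => g _.
  by rewrite mulrN opprK.
move=> FmS dFG F2; rewrite kdiff_flip //.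
have [Fm|Fm] := boolP (F \in first_faces S m).
  rewrite u'_low // big1 ?oppr0 // => g gF; rewrite /w'.
  by case: (apex _) => [x|]; rewrite ?(first_faces_closed (subD1set F g) Fm) mulr0.
have Fs : F \subset nthS m by move: FmS; rewrite first_facesS (negPf Fm).
have FgQ g : (F :\ g \in first_faces S m) = (F :\ g \subset Q).
  apply: first_faces_attach_neq0 => //; last by apply: subset_trans Fs; apply: subD1set.
  rewrite -card_gt0; move: F2; rewrite (cardsD1 g); case: (g \in F) => //.
  by rewrite add0n => /ltnW.
have Fg0 g : exists y, y \in F :\ g.
  suff /set0Pn[y yF] : F :\ g != set0 by exists y.
  rewrite -card_gt0; move: F2; rewrite (cardsD1 g); case: (g \in F) => //.
  by rewrite add0n => /ltnW.
have FQ : ~~ (F \subset Q).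
  rewrite -first_faces_attach_neq0 //.
  by rewrite -card_gt0 ltnW.
have [x apexE [xS xm xQ]] : exists2 x, apex (F :|: G) = Some x &
    [/\ x \in F :|: G, x \in nthS m & forall y, y \in F :|: G -> y \in Q -> x \in Q].
  rewrite /apex; case: pickP => [x|noQ].
    rewrite !inE => /andP[xW /andP[xU xm]]; exists x => //; split=> //; first by rewrite inE.
    by move=> y _ _; rewrite inE xU.
  case: pickP => [x|noS].
    rewrite inE => /andP[xW xm]; exists x => //; split=> // y yW yQ.
    by have := noQ y; rewrite inE yW yQ.
  have /card_gt0P[y yF] : (0 < #|F|)%N by apply: ltnW.
  by have := noS y; rewrite !inE yF (subsetP Fs).
have WE g : g \in F -> F :\ g :|: (g |: G) = F :|: G.
  by move=> gF; rewrite setUCA setUA setD1K.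
have w'E g : g \in F -> w' (F :\ g) (g |: G) =
    if (F :\ g \notin first_faces S m) && (x \in g |: G)
    then - (ksgn K x ((g |: G) :\ x) * u' (x |: F :\ g) ((g |: G) :\ x)) else 0.
  move=> gF; rewrite /w' WE // apexE.
  by have -> : F :\ g \subset nthS m by apply: subset_trans Fs; apply: subD1set.
have xQg g : F :\ g \in first_faces S m -> x \in Q /\ F :\ g \subset Q.
  rewrite FgQ => FgQ'; split=> //; have [y yF] := Fg0 g.
  apply: (xQ y); last exact: (subsetP FgQ').
  by move: yF; rewrite !inE => /andP[_ ->].
have [xF|xF] := boolP (x \in F).
  have xG : x \notin G by rewrite (disjointFr dFG xF).
  rewrite (bigD1 x) //= big1 => [|g /andP[gF gx]]; last first.
    rewrite w'E // in_setU1 (negPf xG) [x == g]eq_sym (negPf gx) andbF.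
    by rewrite mulr0.
  rewrite w'E // setU11 setU1K // setD1K // andbT ifT; last first.
    apply/negP => /xQg[xQ' sFxQ]; case/negP: FQ.
    by rewrite -(setD1K xF) subUset sub1set xQ'.
  by rewrite mulrN addr0 opprK mulrA ksgn_sqr mul1r.
have xG : x \in G by move: xS; rewrite inE (negPf xF).
pose G0 := G :\ x; have GE : G = x |: G0 by rewrite setD1K.
have xG0 : x \notin G0 by rewrite !inE eqxx.
have xFG0 : face_pair Delta (x |: F) G0.
  apply/andP; split.
    by apply/first_facesP; exists m => //; rewrite subUset sub1set xm.
  by rewrite disjoint_sym disjoint_move // disjoint_sym.
have := u'_cycle _ _ xFG0; rewrite kdiff_flip; last by case/andP: xFG0.
rewrite big_setU1 //= setU1K // -GE => /eqP; rewrite oppr_eq0 addr_eq0 => /eqP cyc.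
transitivity (ksgn K x G0 * (ksgn K x G0 * u' F G)); last by rewrite mulrA ksgn_sqr mul1r.
rewrite {}cyc mulrN mulr_sumr; congr (- _); apply: eq_bigr => g gF.
have gx : g != x by apply: contraNneq xF => <-.
have gG : g \notin G by rewrite (disjointFr dFG gF).
have gG0 : g \notin G0 by rewrite !inE (negPf gG) andbF.
have xgG : (g |: G) :\ x = g |: G0.
  by rewrite GE setUCA setU1K // in_setU1 negb_or xG0 eq_sym gx.
have xFg : (x |: F) :\ g = x |: F :\ g.
  by apply/setP => y; rewrite !inE; case: (eqVneq y x) => // ->; rewrite eq_sym gx.
rewrite w'E // xgG in_setU1 xG orbT andbT xFg.
case: (boolP (F :\ g \in first_faces S m)) => [/xQg[xQ' FgQ']|_] /=; last first.
  by rewrite mulrN mulrA [in LHS]GE ksgn_swap // mulNr opprK mulrA.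
rewrite mulr0 u'_low ?mulr0 //.
- rewrite first_faces_attach_neq0 //; first by rewrite subUset sub1set xQ'.
    by apply/set0Pn; exists x; rewrite setU11.
  by rewrite subUset sub1set xm; apply: subset_trans Fs; apply: subD1set.
- by rewrite -xFg disjoint_move //; case/andP: xFG0.
- by rewrite cardsU1 !inE (negPf xF) andbF; move: F2; rewrite (cardsD1 g) gF.
Qed.

End ForestAcyclic.

(** * Ranks and sizes of slices *)

Section SliceRanks.
Variables (K : fieldType) (T : finType).
Implicit Types (Sigma : {set {set T}}) (F G : {set T}).
Local Notation flip := (@flip_weight K T).

Lemma slice_moveE Sigma j s F G g : complex_closed Sigma -> face_pair Sigma F G ->
  g \in F -> ((F :\ g, g |: G) \in slice Sigma j s) = ((F, G) \in slice Sigma j s.+1).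
Proof.
move=> SC FG gF; have /andP[FS dFG] := FG.
have gG : g \notin G by rewrite (disjointFr dFG gF).
rewrite !inE /pair_deg /= FG /face_pair (SC _ _ (subD1set F g)) // disjoint_move //=.
by rewrite cardsU1 gG [in RHS](cardsD1 g F) gF !add1n eqSS addSn addnS.
Qed.

(** Acyclicity in size s.+1 for cochains on all pairs gives exactness at slice
    s.+1: a row extended by zero is a cycle in every size. *)
Lemma slice_rank_exact Sigma j s : complex_closed Sigma ->
  (forall u : {set T} -> {set T} -> K,
    (forall F G, face_pair Sigma F G -> kdiff flip u F G = 0) ->
    exists w, forall F G, face_pair Sigma F G -> #|F| = s.+1 -> u F G = kdiff flip w F G) ->
  (slice_rank K Sigma j s + slice_rank K Sigma j s.+1 = #|slice Sigma j s.+1|)%N.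
Proof.
move=> SC exact; rewrite /slice_rank.
set A := smx _ _ _; set B := smx (slice _ _ s.+1) _ _.
rewrite -[RHS](subnK (rank_leq_row B)) -mxrank_ker; congr (_ + _)%N.
apply: eqmx_rank; apply/andP; split; apply/rV_subP => v.
  case/submxP=> w ->; apply/sub_kermxP; rewrite /A /B !mul_row_diff.
  apply/rowP => b; rewrite !mxE; have := enum_valP b.
  case: (enum_val b) => F G FGb /=.
  rewrite (@eq_kdiff _ _ _ _ (kdiff flip (curried (zext w)))) => [|g gG].
    by rewrite kdiff_sqr //; apply: flip_weightD.
  rewrite /flip_weight; case: (boolP (g \in F)) => gF; last by rewrite eqxx.
  move=> _; rewrite /curried zext_restr // slice_moveE //.
  by move: FGb; rewrite inE => /andP[].
move=> /sub_kermxP; rewrite /B mul_row_diff => v0.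
have [F G FG|w Hw] := exact (curried (zext v)).
  have [FGs|FGs] := boolP ((F, G) \in slice Sigma j s.+2).
    have [b E] := set_enum_val FGs.
    by have /rowP/(_ b) := v0; rewrite !mxE -E.
  rewrite kdiff_flip; last by case/andP: FG.
  rewrite big1 ?oppr0 // => g gF.
  by rewrite /curried zext_out ?mulr0 // slice_moveE.
apply/submxP; exists (restr (slice Sigma j s) (fun q => w q.1 q.2)).
rewrite /A mul_row_diff -[LHS]restr_zext; apply: eq_restr => -[F G] FGs /=.
have := FGs; rewrite inE /= => /and3P[FG /eqP Fs _].
rewrite -[LHS]/(curried (zext v) F G) Hw //; apply: eq_kdiff => g gG.
rewrite /flip_weight; case: (boolP (g \in F)) => gF; last by rewrite eqxx.
by move=> _; rewrite /curried zext_restr // slice_moveE.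
Qed.

(** When every vertex is a face, the coefficient at (set0, G) is recovered, up to
    sign, from the value of the operator at ([set g], G :\ g) for any g in G. *)
Lemma slice_rank_bottom Sigma j : complex_closed Sigma -> (0 < j)%N ->
  (forall x, [set x] \in Sigma) -> slice_rank K Sigma j 0 = #|slice Sigma j 0|.
Proof.
move=> SC j0 S1; apply/eqP; rewrite -/(row_free _) -kermx_eq0 -submx0.
apply/rV_subP => v /sub_kermxP; rewrite mul_row_diff => v0.
suff -> : v = 0 by apply: sub0mx.
rewrite -[LHS]restr_zext; apply/rowP => b; rewrite !mxE.
have := enum_valP b; case: (enum_val b) => F G FG.
have := FG; rewrite inE cards_eq0 /pair_deg /= => /and3P[_ /eqP F0 /eqP GE].
move: FG GE; rewrite {}F0 cards0 add0n => FG GE.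
have [g gG] : exists g, g \in G by apply/card_gt0P; rewrite GE.
have gG1 : [disjoint [set g] & G :\ g] by rewrite disjoints1 !inE eqxx.
have res1 : face_pair Sigma [set g] (G :\ g) by rewrite /face_pair S1 gG1.
have E0 : [set g] :\ g = set0 by apply/eqP; rewrite setD_eq0.
have : ([set g], G :\ g) \in slice Sigma j 1.
  by rewrite -(@slice_moveE Sigma j 0 _ _ g) ?set11 // E0 setD1K.
case/set_enum_val=> c cE; have /rowP/(_ c) := v0; rewrite !mxE -cE /= kdiff_flip //.
rewrite big_set1 E0 setD1K // /curried => /eqP; rewrite oppr_eq0 => /eqP z.
by rewrite -[LHS]mul1r -(ksgn_sqr K g (G :\ g)) -mulrA z mulr0.
Qed.

Definition face_count Sigma s : nat := #|[set F in Sigma | #|F| == s]|.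

Lemma card_slice Sigma j s : (s <= j)%N ->
  #|slice Sigma j s| = (face_count Sigma s * 'C(#|T| - s, j - s))%N.
Proof.
move=> sj; rewrite -sum1_card.
rewrite (eq_bigl (fun p : {set T} * {set T} => ((p.1 \in Sigma) && (#|p.1| == s)) &&
   ((p.2 \subset ~: p.1) && (#|p.2| == (j - s)%N)))); last first.
  move=> [F G]; rewrite inE /face_pair /pair_deg /= disjoint_sym disjoints_subset.
  case: (F \in Sigma) => //=; case: (G \subset _); rewrite ?andbF //=.
  case: eqP => // -> /=; apply/eqP/eqP; lia.
rewrite -(pair_big_dep (fun F : {set T} => (F \in Sigma) && (#|F| == s))
  (fun F G : {set T} => (G \subset ~: F) && (#|G| == (j - s)%N)) (fun _ _ => 1%N)) /=.
rewrite /face_count -sum1_card big_distrl /=.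
rewrite [RHS](eq_bigl (fun F => (F \in Sigma) && (#|F| == s))) => [|F]; last by rewrite inE.
apply: eq_bigr => F /andP[_ /eqP Fs]; rewrite mul1n.
by rewrite sum1dep_card cards_draws cardsCs setCK Fs.
Qed.

Lemma slice_high Sigma j s : (j < s)%N -> slice Sigma j s = set0.
Proof.
move=> js; apply/setP => p; rewrite !inE; apply/negP => /and3P[_ /eqP E].
by rewrite /pair_deg E; lia.
Qed.

End SliceRanks.

(** * Counting the faces of the clique complex *)

(** Both sides count the j-subsets of an N-set that miss a given n-subset, the left
    one by inclusion-exclusion over the t-subsets of their intersection with it. *)
Lemma alternating_binomial (n N j : nat) : (n <= N)%N ->
  \sum_(0 <= t < j.+1) (-1) ^+ t * ('C(n, t) * 'C(N - t, j - t))%:Z = 'C(N - n, j)%:Z.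
Proof.
elim: n N j => [|n IH] N j nN.
  rewrite big_nat_recl // big1_seq => [|t _]; last by rewrite bin0n mul0n mulr0.
  by rewrite expr0 mul1r bin0 mul1n !subn0 addr0.
case: N nN => // N; rewrite ltnS => nN; case: j => [|j].
  by rewrite big_nat1 expr0 mul1r !bin0.
have step t : (-1) ^+ t.+1 * ('C(n.+1, t.+1) * 'C(N.+1 - t.+1, j.+1 - t.+1))%:Z
    = (-1) ^+ t.+1 * ('C(n, t.+1) * 'C(N.+1 - t.+1, j.+1 - t.+1))%:Z
      - (-1) ^+ t * ('C(n, t) * 'C(N - t, j - t))%:Z.
  by rewrite binS mulnDl PoszD mulrDr !subSS [in RHS]exprS exprS mulN1r !mulNr.
have := IH N.+1 j.+1 (leqW nN).
rewrite big_nat_recl // [X in _ -> X = _]big_nat_recl // !bin0.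
under [X in _ -> _ + X = _]eq_bigr => t _ do rewrite step.
rewrite sumrB IH // addrA => ->; rewrite subSn // binS subSS; lia.
Qed.

Section FaceCounts.
Variable T : finType.

Lemma face_countUI (A B : {set {set T}}) s :
  (face_count (A :|: B) s + face_count (A :&: B) s = face_count A s + face_count B s)%N.
Proof.
rewrite /face_count -[RHS]cardsUI; congr (_ + _)%N; apply: eq_card => F; rewrite !inE.
  by rewrite andb_orl.
by rewrite andbACA andbb.
Qed.

Lemma face_count_powerset (A : {set T}) s : face_count (powerset A) s = 'C(#|A|, s).
Proof. by rewrite -cards_draws; apply: eq_card => F; rewrite !inE. Qed.

(** Adding the facet S_m.+1 adds its subsets, except those of the separator, which
    are already there. *)
Lemma face_count_first_faces (S : seq {set T}) m s : leafy S -> (m < size S)%N ->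
  (face_count (first_faces S m.+1) s + \sum_(0 <= i < m) 'C(sep_card S i, s)
   = \sum_(0 <= i < m.+1) 'C(facet_card S i, s))%N.
Proof.
move=> lf; have step k : first_faces S k.+1 = first_faces S k :|: powerset (nth set0 S k).
  by apply/setP => F; rewrite in_setU powersetE first_facesS.
elim: m => [|m IH] mS.
  by rewrite big_nil addn0 big_nat1 step first_faces0 set0U face_count_powerset.
rewrite big_nat_recr //= [RHS]big_nat_recr //= -IH 1?ltnW //.
rewrite addnA [LHS]addnAC [RHS]addnAC; congr (_ + _)%N.
rewrite -!face_count_powerset -[RHS]face_countUI -step; congr (_ + face_count _ _)%N.
by apply/setP => F; rewrite in_setI !powersetE first_faces_attach.
Qed.

End FaceCounts.

Section CliqueComplex.
Variables (T : finType) (adj : rel T) (S : seq {set T}).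
Hypothesis S_leaf : leaf_order (clique_complex adj) S.
Local Notation Delta := (clique_complex adj).

Lemma clique_closed : complex_closed Delta.
Proof.
move=> F F' /subsetP FF'; rewrite !inE => /forall_inP H; apply/forall_inP => x xF.
apply/forall_inP => y yF; have /forall_inP H' := H x (FF' x xF).
exact: H' (FF' y yF).
Qed.

Lemma clique_set0 : set0 \in Delta.
Proof. by rewrite inE; apply/forall_inP => x; rewrite inE. Qed.

Lemma clique_set1 x : [set x] \in Delta.
Proof.
rewrite inE; apply/forall_inP => y /set1P ->; apply/forall_inP => z /set1P ->.
by rewrite eqxx.
Qed.

Lemma leaf_order_leafy : leafy S.
Proof. by case: S_leaf. Qed.

Lemma leaf_order_faces : Delta = first_faces S (size S).
Proof.
case: S_leaf => _ SE _; apply/setP => F; apply/idP/first_facesP => [FD|[i iS Fi]].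
  have [A maxA FA] := maxset_exists (P := fun A => A \in Delta) FD.
  have AS : A \in S by rewrite SE inE.
  by exists (index A S); rewrite ?index_mem ?nth_index.
have := mem_nth set0 iS; rewrite SE inE => /maxsetp; exact: clique_closed.
Qed.

Lemma leaf_order_gt0 : (0 < size S)%N.
Proof.
by move: clique_set0; rewrite leaf_order_faces => /first_facesP[i /(leq_ltn_trans _)->].
Qed.

End CliqueComplex.

(** * Betti numbers of complexes that agree with the clique complex *)

Section Forest.
Variables (K : fieldType) (T : finType) (adj : rel T) (S : seq {set T}).
Hypothesis S_leaf : leaf_order (clique_complex adj) S.
Local Notation Delta := (clique_complex adj).
Local Notation N := #|T|.
Local Notation e := (size S).
Local Notation f := (face_count Delta).
Local Notation c j s := (f s * 'C(N - s, j - s))%N.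

Lemma clique_face_count s :
  (f s)%:Z = (\sum_(0 <= m < e) 'C(facet_card S m, s))%N%:Z
    - (\sum_(0 <= m < e - 1) 'C(sep_card S m, s))%N%:Z.
Proof.
have lf := leaf_order_leafy S_leaf.
have := @face_count_first_faces T S (size S).-1 s lf.
rewrite prednK ?(leaf_order_gt0 S_leaf) // leqnn -(leaf_order_faces S_leaf) // subn1 => /(_ isT) <-; lia.
Qed.

Lemma clique_rank_exact j s : (1 <= s)%N ->
  (slice_rank K Delta j s + slice_rank K Delta j s.+1 = #|slice Delta j s.+1|)%N.
Proof.
move=> s1; apply: slice_rank_exact; first exact: clique_closed.
move=> u; rewrite (leaf_order_faces S_leaf).
move/(forest_acyclic (leaf_order_leafy S_leaf)) => [w Hw].
by exists w => F G FG Fs; apply: Hw; rewrite // Fs.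
Qed.

Lemma clique_rank_bottom j : (0 < j)%N -> slice_rank K Delta j 0 = #|slice Delta j 0|.
Proof.
move=> j0; apply: slice_rank_bottom => //; first exact: clique_closed.
exact: clique_set1.
Qed.

(** Exactness at all slices above s determines the rank, working down from the
    empty slice j.+1. *)
Lemma clique_rank j s : (1 <= s <= j)%N ->
  (slice_rank K Delta j s)%:Z = \sum_(s.+1 <= t < j.+1) (-1) ^+ (t - s.+1) * (c j t)%:Z.
Proof.
case/andP=> s1 sj; have [k] := ubnP (j - s); elim: k s s1 sj => // k IH s s1 sj.
rewrite ltnS => jsk; case: (ltnP s j) => [sj'|js]; last first.
  have -> : s = j by apply/eqP; rewrite eqn_leq sj.
  by rewrite big_geq // slice_rank_out // slice_high.
rewrite big_ltn // subnn expr0 mul1r -card_slice //.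
rewrite -(clique_rank_exact j s1) PoszD (IH s.+1) //; last by lia.
rewrite -addrA -[LHS]addr0; congr (_ + _); rewrite -big_split /= big1_seq //= => t.
rewrite mem_index_iota => /andP[st _].
by rewrite subnS -[in X in _ + X](@prednK (t - s.+1)) ?subn_gt0 // exprS mulN1r mulNr addrN.
Qed.

(** Linear combination of alternating_binomial over the facets and the separators. *)
Lemma alternating_faces j :
  \sum_(0 <= t < j.+1) (-1) ^+ t * (c j t)%:Z
    = (\sum_(0 <= m < e) 'C(N - facet_card S m, j))%N%:Z
      - (\sum_(0 <= m < e - 1) 'C(N - sep_card S m, j))%N%:Z.
Proof.
have sep_le m : (sep_card S m <= N)%N by apply: max_card.
have fac_le m : (facet_card S m <= N)%N by apply: max_card.
have termE t : (-1) ^+ t * (c j t)%:Z =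
    \sum_(0 <= m < e) (-1) ^+ t * ('C(facet_card S m, t) * 'C(N - t, j - t))%:Z
    - \sum_(0 <= m < e - 1) (-1) ^+ t * ('C(sep_card S m, t) * 'C(N - t, j - t))%:Z.
  rewrite -!mulr_sumr -mulrBr PoszM clique_face_count mulrBl; congr (_ * (_ - _)).
    by rewrite -PoszM big_distrl /= (big_morph Posz PoszD (erefl _)).
  by rewrite -PoszM big_distrl /= (big_morph Posz PoszD (erefl _)).
rewrite (eq_bigr _ (fun t _ => termE t)) sumrB !(big_morph Posz PoszD (erefl _)).
congr (_ - _); rewrite exchange_big_nat; apply: eq_bigr => m _; exact: alternating_binomial.
Qed.

(** The Betti number at slice s depends on the slices s - 1, s and s + 1 only, so
    each of the next lemmas asks Sigma to agree with the clique complex just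
    there. *)
Section LinearStrand.
Variables (Sigma : {set {set T}}) (beta : nat -> nat -> nat).
Hypotheses (SigmaC : complex_closed Sigma) (Sigma0 : set0 \in Sigma).
Hypothesis betti : sr_betti K Sigma beta.

Lemma slice_rank_eq j s : slice Sigma j s = slice Delta j s ->
  slice Sigma j s.+1 = slice Delta j s.+1 -> slice_rank K Sigma j s = slice_rank K Delta j s.
Proof. by rewrite /slice_rank => -> ->. Qed.

Lemma betti_slice0 i : (1 <= i)%N ->
  (forall s, (s <= 1)%N -> slice Sigma i s = slice Delta i s) -> beta i i = 0%N.
Proof.
move=> i1 sl; have [/(_ i 0%N) + _] := sr_betti_slices SigmaC Sigma0 betti.
rewrite addn0 addn0 slice_rank_eq ?sl // clique_rank_bottom //; lia.
Qed.

Lemma betti_slice_mid i s : (2 <= s)%N ->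
  (forall t, (t <= s.+1)%N -> slice Sigma (i + s) t = slice Delta (i + s) t) ->
  beta i (i + s)%N = 0%N.
Proof.
move=> s2 sl; have [/(_ i s) + _] := sr_betti_slices SigmaC Sigma0 betti.
case: s s2 sl => // s s1 sl.
have E t : (t <= s.+1)%N -> slice_rank K Sigma (i + s.+1) t = slice_rank K Delta (i + s.+1) t.
  by move=> ts; apply: slice_rank_eq; apply: sl => //; lia.
rewrite !E // sl; last by lia.
have := @clique_rank_exact (i + s.+1) s s1; lia.
Qed.

Lemma betti_slice1 i : (1 <= i)%N ->
  (forall t, (t <= 2)%N -> slice Sigma i.+1 t = slice Delta i.+1 t) ->
  (beta i (i + 1))%:Z = - \sum_(0 <= t < i.+2) (-1) ^+ t * (c i.+1 t)%:Z.
Proof.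
move=> i1 sl; have [/(_ i 1%N) + _] := sr_betti_slices SigmaC Sigma0 betti.
rewrite addn1 !slice_rank_eq ?sl // clique_rank_bottom //.
rewrite !card_slice // big_ltn // big_ltn //.
have := @clique_rank i.+1 1%N isT; rewrite (eq_big_nat _ _ (F2 := fun t =>
  (-1) ^+ t * (c i.+1 t)%:Z)) => [|t /andP[t2 _]].
  rewrite expr0 expr1; move: (bigop _ _ _) (f 0%N * _)%N (f 1%N * _)%N => x a b; lia.
by congr (_ * _); rewrite -[in RHS](subnK t2) exprD sqrrN expr1n mulr1.
Qed.

Lemma betti_slice1_formula i : (1 <= i)%N ->
  (forall t, (t <= 2)%N -> slice Sigma i.+1 t = slice Delta i.+1 t) ->
  (beta i (i + 1))%:Z =
    - (\sum_(0 <= m < e) zbin (N%:Z - (facet_card S m)%:Z) (i%:Z + 1))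
    + \sum_(0 <= m < e - 1) zbin (N%:Z - (sep_card S m)%:Z) (i%:Z + 1).
Proof.
move=> i1 sl; rewrite betti_slice1 // alternating_faces opprB addrC.
have zE m : (m <= N)%N -> zbin (N%:Z - m%:Z) (i%:Z + 1) = 'C(N - m, i.+1)%:Z.
  by move=> mN; rewrite subzn // -PoszD addn1.
rewrite !(big_morph Posz PoszD (erefl _)).
by congr (- _ + _); apply: eq_bigr => m _; rewrite zE // max_card.
Qed.

(** At the top of the skeleton the map to slice k.+2 has disappeared, so the homology
    is the cokernel of the map into slice k.+1. By exactness in the clique complex
    this cokernel is isomorphic to the image of the removed map. *)
Lemma betti_top i k : (1 <= k)%N ->
  (forall t, (t <= k.+1)%N -> slice Sigma (i + k.+1) t = slice Delta (i + k.+1) t) ->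
  slice Sigma (i + k.+1) k.+2 = set0 ->
  (beta i (i + k.+1))%:Z =
    \sum_(k.+2 <= t < (i + k.+1).+1) (-1) ^+ (t - k.+2) * (c (i + k.+1) t)%:Z.
Proof.
move=> k1 sl sl0; have [/(_ i k.+1) + _] := sr_betti_slices SigmaC Sigma0 betti.
have E t : (t <= k)%N -> slice_rank K Sigma (i + k.+1) t = slice_rank K Delta (i + k.+1) t.
  by move=> tk; apply: slice_rank_eq; apply: sl => //; lia.
rewrite slice_rank_out // E // sl // -(@clique_rank_exact (i + k.+1) k k1) => Ebeta.
by rewrite -clique_rank; lia.
Qed.

Lemma betti_top_formula i k : (1 <= k)%N ->
  (forall t, (t <= k.+1)%N -> slice Sigma (i + k.+1) t = slice Delta (i + k.+1) t) ->
  slice Sigma (i + k.+1) k.+2 = set0 ->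
  (beta i (i + k + 1))%:Z =
    \sum_(k + 2 <= t < (i + k + 1).+1)
      (-1) ^ (k%:Z - t%:Z)
      * zbin (N%:Z - t%:Z) (i%:Z + k%:Z + 1 - t%:Z)
      * (\sum_(0 <= m < e) zbin (facet_card S m)%:Z t%:Z
         - \sum_(0 <= m < e - 1) zbin (sep_card S m)%:Z t%:Z).
Proof.
move=> k1 sl sl0; rewrite -addnA addn1 betti_top // addn2.
apply: eq_big_nat => t /andP[kt tj].
have -> : \sum_(0 <= m < e) zbin (facet_card S m)%:Z t%:Z
         - \sum_(0 <= m < e - 1) zbin (sep_card S m)%:Z t%:Z = (f t)%:Z.
  by rewrite clique_face_count !(big_morph Posz PoszD (erefl _)).
have sgnE : (-1 : int) ^ (k%:Z - t%:Z) = (-1) ^+ (t - k.+2).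
  rewrite -invrN1 exprz_inv opprB subzn; last by lia.
  have -> : (t - k = t - k.+2 + 2)%N by lia.
  by rewrite -exprnP exprD sqrrN expr1n mulr1.
rewrite sgnE -mulrA; congr (_ * _).
case: (leqP t N) => tN; last first.
  suff -> : f t = 0%N by rewrite mul0n mulr0.
  apply: eq_card0 => F; rewrite inE; apply/negP => /andP[_ /eqP Ft].
  by move: tN; rewrite -Ft ltnNge max_card.
have -> : i%:Z + k%:Z + 1 - t%:Z = (i + k.+1 - t)%N%:Z by lia.
by rewrite subzn // mulrC PoszM.
Qed.

End LinearStrand.
End Forest.

(** * Skeletons *)

Section Skeleton.
Variables (T : finType) (Sigma : {set {set T}}) (k : int) (b : nat).
Hypothesis kb : k + 1 = b%:Z.

Lemma in_skeleton F : (F \in skeleton k Sigma) = (F \in Sigma) && (#|F| <= b)%N.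
Proof. by rewrite inE /face_dim; congr (_ && _); apply/idP/idP; lia. Qed.

Lemma skeleton_closed : complex_closed Sigma -> complex_closed (skeleton k Sigma).
Proof.
move=> SC F F' FF'; rewrite !in_skeleton => /andP[/(SC _ _ FF') -> Fb] /=.
exact: leq_trans (subset_leq_card FF') Fb.
Qed.

Lemma skeleton_set0 : set0 \in Sigma -> set0 \in skeleton k Sigma.
Proof. by rewrite in_skeleton cards0 => ->. Qed.

Lemma slice_skeleton j s : (s <= b)%N ->
  slice (skeleton k Sigma) j s = slice Sigma j s.
Proof.
move=> sb; apply/setP => p; rewrite ![p \in _]inE /face_pair in_skeleton.
by case: eqP => [->|]; rewrite ?sb ?andbT ?andbF.
Qed.

Lemma slice_skeleton_high j s : (b < s)%N -> slice (skeleton k Sigma) j s = set0.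
Proof.
move=> bs; apply/setP => p; rewrite ![p \in _]inE /face_pair in_skeleton.
by case: eqP => [->|]; rewrite ?andbF // leqNgt bs andbF.
Qed.

End Skeleton.

Lemma face_count0 (T : finType) (Sigma : {set {set T}}) :
  set0 \in Sigma -> face_count Sigma 0 = 1%N.
Proof.
move=> S0; rewrite /face_count -(cards1 (@set0 T)); apply: eq_card => F.
by rewrite !inE cards_eq0; case: eqP => [->|]; rewrite ?S0 ?andbF.
Qed.

Lemma face_count1 (T : finType) (Sigma : {set {set T}}) :
  (forall x, [set x] \in Sigma) -> face_count Sigma 1 = #|T|.
Proof.
move=> S1; rewrite -[RHS]bin1 -cardsT -cards_draws; apply: eq_card => F.
by rewrite !inE subsetT /= andb_idl // => /cards1P[x ->].
Qed.

Theorem theorem1 (K : fieldType) (T : finType) (adj : rel T)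
    (adj_sym : symmetric adj) (adj_irr : irreflexive adj)
    (adj_chordal : chordal adj)
    (S : seq {set T}) (S_leaf : leaf_order (clique_complex adj) S)
    (S_ge2 : (2 <= size S)%N) :
  let Delta := clique_complex adj in
  let N := #|T| in
  let e := size S in
  let n := facet_card S in
  let r := sep_card S in
  let d := cdim Delta in
  [/\
    (* (a) *)
    forall beta, sr_betti K (skeleton (-1) Delta) beta ->
      (forall i : nat, (i <= N)%N -> beta i i = 'C(N, i)) /\
      (forall i j : nat, ~ (j = i /\ (i <= N)%N) -> beta i j = 0%N),
    (* (b) *)
    forall beta, sr_betti K (skeleton 0 Delta) beta ->
      (forall i : nat, (1 <= i <= N - 1)%N ->
         beta i (i + 1)%N = (i * 'C(N, i + 1))%N) /\
      (forall i j : nat, (1 <= i)%N ->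
         ~ (j = (i + 1)%N /\ (i <= N - 1)%N) -> beta i j = 0%N),
    (* (c) *)
    forall (k : nat) beta, (1 <= k)%N -> k%:Z < d ->
      sr_betti K (skeleton k%:Z Delta) beta ->
      forall i : nat, (1 <= i)%N ->
      [/\ (beta i (i + 1)%N)%:Z =
            - (\sum_(0 <= m < e) zbin (N%:Z - (n m)%:Z) (i%:Z + 1))
            + \sum_(0 <= m < e - 1) zbin (N%:Z - (r m)%:Z) (i%:Z + 1),
          (beta i (i + k + 1)%N)%:Z =
            \sum_(k + 2 <= t < (i + k + 1).+1)
              (-1) ^ (k%:Z - t%:Z)
              * zbin (N%:Z - t%:Z) (i%:Z + k%:Z + 1 - t%:Z)
              * (\sum_(0 <= m < e) zbin (n m)%:Z t%:Z
                 - \sum_(0 <= m < e - 1) zbin (r m)%:Z t%:Z)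
        & forall j : nat, j <> (i + 1)%N -> j <> (i + k + 1)%N ->
            beta i j = 0%N]
  & (* (d) *)
    skeleton d Delta = Delta /\
    forall beta, sr_betti K Delta beta ->
      forall i : nat, (1 <= i)%N ->
      (beta i (i + 1)%N)%:Z =
        - (\sum_(0 <= m < e) zbin (N%:Z - (n m)%:Z) (i%:Z + 1))
        + \sum_(0 <= m < e - 1) zbin (N%:Z - (r m)%:Z) (i%:Z + 1)
      /\ forall j : nat, j <> (i + 1)%N -> beta i j = 0%N].
Proof.
move=> Delta N e n r d.
have DC : complex_closed Delta by apply: clique_closed.
have D0 : set0 \in Delta by apply: clique_set0.
have D1 x : [set x] \in Delta by apply: clique_set1.
split.
- move=> beta b.
  have kb : (-1 : int) + 1 = 0%N%:Z by [].
  have [H low] := sr_betti_slices (skeleton_closed kb DC) (skeleton_set0 kb D0) b.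
  have diag i : beta i i = 'C(N, i).
    have := H i 0%N; rewrite !addn0 slice_rank_out; last exact: (slice_skeleton_high _ kb).
    rewrite ?addn0.
    rewrite (slice_skeleton Delta kb) // card_slice // !subn0 face_count0 // mul1n.
    by [].
  split=> // i j ne; case: (ltngtP j i) => [|ij|ji]; first exact: low.
    have := H i (j - i)%N; rewrite subnKC ?(ltnW ij) // (slice_skeleton_high _ kb) ?subn_gt0 //.
    by rewrite cards0; lia.
  rewrite ji diag bin_small // ltnNge; apply/negP => iN; exact: ne.
- move=> beta b; have kb : (0 : int) + 1 = 1%N%:Z by [].
  have SC := skeleton_closed kb DC; have S0 := skeleton_set0 kb D0.
  have sl j s : (s <= 1)%N -> slice (skeleton 0 Delta) j s = slice Delta j s.
    exact: slice_skeleton.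
  have [H low] := sr_betti_slices SC S0 b.
  have diag i : (1 <= i)%N -> beta i (i + 1)%N = (i * 'C(N, i + 1))%N.
    move=> i1; have := H i 1%N.
    rewrite slice_rank_out; last exact: (slice_skeleton_high _ kb).
    rewrite addn0.
    rewrite (@slice_rank_eq K T adj _ (i + 1) 0) ?sl //.
    rewrite (clique_rank_bottom K) ?addn1 // !card_slice // face_count0 // face_count1 //.
    by rewrite !subn0 mul1n subn1 subn1 /= mul_bin_diag mulSn addnC => /addnI.
  split=> [i /andP[i1 _]|i j i1 ne]; first exact: diag.
  case: (ltnP j i) => [|ij]; first exact: low.
  have [s jE] : exists s, j = (i + s)%N by exists (j - i)%N; rewrite subnKC.
  move: ne; rewrite {}jE {ij}; case: s => [|[|s]] ne.
  + by rewrite addn0; apply: (betti_slice0 SC S0 b) => // s; apply: sl.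
  + rewrite diag // bin_small ?muln0 //.
    have : ~ (i <= N - 1)%N by move=> H1; apply: ne.
    lia.
  + have := H i s.+2; rewrite (slice_skeleton_high _ kb) // cards0; lia.
- move=> k beta k1 _ b i i1; have kb : k%:Z + 1 = k.+1%:Z by lia.
  have SC := skeleton_closed kb DC; have S0 := skeleton_set0 kb D0.
  have sl j s : (s <= k.+1)%N -> slice (skeleton k Delta) j s = slice Delta j s.
    exact: slice_skeleton.
  have [H low] := sr_betti_slices SC S0 b.
  split.
  + apply: (betti_slice1_formula S_leaf SC S0 b) => // t t2; apply: sl; lia.
  + apply: (betti_top_formula S_leaf SC S0 b) => // [t tk|]; first exact: sl.
    exact: (slice_skeleton_high _ kb).
  + move=> j j1 j2; case: (ltnP j i) => [|ij]; first exact: low.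
    have [s jE] : exists s, j = (i + s)%N by exists (j - i)%N; rewrite subnKC.
    move: j1 j2; rewrite {}jE {ij}; case: s => [|[|s]] // j1 j2.
      by rewrite addn0; apply: (betti_slice0 SC S0 b) => // s s1; apply: sl; lia.
    case: (ltnP s.+2 k.+1) => sk.
      by apply: (betti_slice_mid S_leaf SC S0 b) => // t ts; apply: sl; lia.
    have := H i s.+2; rewrite (slice_skeleton_high _ kb) ?cards0; lia.
- split.
    apply/setP => F; rewrite inE; case: (boolP (F \in Delta)) => //= FD.
    rewrite /face_dim /d /cdim lerB // lez_nat.
    exact: (leq_bigmax_cond (F := fun F : {set T} => #|F|) F FD).
  move=> beta b i i1; split.
    by apply: (betti_slice1_formula S_leaf DC D0 b).
  have [H low] := sr_betti_slices DC D0 b.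
  move=> j j1; case: (ltnP j i) => [|ij]; first exact: low.
  have [s jE] : exists s, j = (i + s)%N by exists (j - i)%N; rewrite subnKC.
  move: j1; rewrite {}jE {ij}; case: s => [|[|s]] // j1.
    by rewrite addn0; apply: (betti_slice0 DC D0 b).
  by apply: (betti_slice_mid S_leaf DC D0 b).
Qed.
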